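(* Let $g\geq 1$ and, for each $n$, let $K_n$ be the kernel of the reduced Burau representation of the pure braid group $PB_n$ evaluated at $t=-1$. Then $Z(K_{2g+2})=Z(B_{2g+2})$ and \[ K_{2g+2}/Z(B_{2g+2}) \cong \bigl(K_{2g+1}/Z(K_{2g+1})\bigr) \ltimes F_{\infty}, \] a semidirect product in which $F_\infty$ is the normal factor.
   Context: $B_n$ denotes the braid group on $n$ strands and $PB_n$ its pure braid subgroup; $Z(G)$ denotes the center of a group $G$. The reduced Burau representation is the standard representation $B_n\to GL_{n-1}(\mathbb{Z}[t,t^{-1}])$; here it is restricted to $PB_n$ and specialized at $t=-1$. $F_\infty$ denotes the free group of countably infinite rank. *)

(* Defs.v *)
From HB Require Import structures.
From mathcomp Require Import all_boot all_order all_algebra fingroup perm.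
From mathcomp Require Import generic_quotient boolp.
From mathcomp Require Import ring zify.

Set Implicit Arguments.
Unset Strict Implicit.
Unset Printing Implicit Defensive.

Import Order.TTheory GRing.Theory.

Local Open Scope group_scope.
Local Open Scope quotient_scope.

(* A letter [(i, false)] stands for the generator [i], and [(i, true)] for its
   inverse. *)
Definition word (I : choiceType) := seq (I * bool)%type.

Definition inv_word (I : choiceType) (w : word I) : word I :=
  rev [seq (a.1, ~~ a.2) | a <- w].

Section Presentation.
Variables (I : choiceType) (R : word I -> word I -> Prop).

Inductive pres_eq : word I -> word I -> Prop :=
| pres_eq_rel u v : R u v -> pres_eq u v
| pres_eq_cancel i b : pres_eq [:: (i, b); (i, ~~ b)] [::]
| pres_eq_cat u u' v v' : pres_eq u u' -> pres_eq v v' ->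
    pres_eq (u ++ v) (u' ++ v')
| pres_eq_refl u : pres_eq u u
| pres_eq_sym u v : pres_eq u v -> pres_eq v u
| pres_eq_trans v u w : pres_eq u v -> pres_eq v w -> pres_eq u w.

Definition pres_eqb : rel (word I) := fun u v => `[< pres_eq u v >].

Lemma pres_eqb_refl : reflexive pres_eqb.
Proof. by move=> u; apply/asboolP; exact: pres_eq_refl. Qed.

Lemma pres_eqb_sym : symmetric pres_eqb.
Proof. by move=> u v; apply/asboolP/asboolP; exact: pres_eq_sym. Qed.

Lemma pres_eqb_trans : transitive pres_eqb.
Proof.
move=> v u w /asboolP uv /asboolP vw.
by apply/asboolP; exact: pres_eq_trans uv vw.
Qed.

Canonical pres_equiv :=
  EquivRel pres_eqb pres_eqb_refl pres_eqb_sym pres_eqb_trans.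

(* The group with generators [I] and a relation [u = v] whenever [R u v]. *)
Definition pres_group := {eq_quot pres_equiv}.

HB.instance Definition _ := Choice.on pres_group.

Definition pres_class (w : word I) : pres_group := \pi_{eq_quot pres_equiv} w.
Local Notation cls := pres_class.

Lemma pres_group_ind (P : pres_group -> Prop) :
  (forall u, P (cls u)) -> forall x, P x.
Proof. exact: quotW. Qed.

Lemma pres_piP u v : cls u = cls v <-> pres_eq u v.
Proof. by split=> [/eqquotP /asboolP|uv]; last by apply/eqquotP/asboolP. Qed.

Lemma pres_eq_repr u : pres_eq (repr (cls u)) u.
Proof. by apply/pres_piP; rewrite /pres_class reprK. Qed.

Lemma pres_eq_mulwV w : pres_eq (w ++ inv_word w) [::].
Proof.
elim: w => [|[i b] w IHw]; first exact: pres_eq_refl.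
have -> : ((i, b) :: w) ++ inv_word ((i, b) :: w)
    = [:: (i, b)] ++ ((w ++ inv_word w) ++ [:: (i, ~~ b)]).
  by rewrite /inv_word /= rev_cons -cats1 catA.
apply: (pres_eq_trans (v := [:: (i, b)] ++ ([::] ++ [:: (i, ~~ b)]))).
  apply: pres_eq_cat; first exact: pres_eq_refl.
  by apply: pres_eq_cat IHw _; exact: pres_eq_refl.
exact: pres_eq_cancel.
Qed.

Lemma inv_wordK : involutive (@inv_word I).
Proof.
move=> w; rewrite /inv_word map_rev revK -map_comp map_id_in //.
by case=> i b _ /=; rewrite negbK.
Qed.

Lemma inv_word_cat (u v : word I) :
  inv_word (u ++ v) = inv_word v ++ inv_word u.
Proof. by rewrite /inv_word map_cat rev_cat. Qed.

Lemma pres_eq_inv u v : pres_eq u v -> pres_eq (inv_word u) (inv_word v).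
Proof.
move=> uv; apply: (@pres_eq_trans (inv_word u ++ (v ++ inv_word v))).
  rewrite -[X in pres_eq X _]cats0; apply: pres_eq_cat (pres_eq_refl _) _.
  exact/pres_eq_sym/pres_eq_mulwV.
rewrite catA -[X in pres_eq _ X]cat0s.
apply: pres_eq_cat (pres_eq_refl _).
apply: (@pres_eq_trans (inv_word u ++ u)).
  by apply: pres_eq_cat (pres_eq_refl _) _; exact: pres_eq_sym.
by rewrite -{2}(inv_wordK u); exact: pres_eq_mulwV.
Qed.

Definition pres_one : pres_group := cls [::].
Definition pres_mul (x y : pres_group) : pres_group := cls (repr x ++ repr y).
Definition pres_inv (x : pres_group) : pres_group := cls (inv_word (repr x)).

Lemma pi_pres_mul u v :
  pres_mul (cls u) (cls v) = cls (u ++ v).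
Proof. by apply/pres_piP/pres_eq_cat; exact: pres_eq_repr. Qed.

Lemma pi_pres_inv u : pres_inv (cls u) = cls (inv_word u).
Proof. by apply/pres_piP/pres_eq_inv; exact: pres_eq_repr. Qed.

Lemma pres_mulA : associative pres_mul.
Proof.
by elim/pres_group_ind=> u; elim/pres_group_ind=> v; elim/pres_group_ind=> w; rewrite !pi_pres_mul catA.
Qed.

Lemma pres_mul1 : left_id pres_one pres_mul.
Proof. by elim/pres_group_ind=> u; rewrite pi_pres_mul. Qed.

Lemma pres_mulr1 : right_id pres_one pres_mul.
Proof. by elim/pres_group_ind=> u; rewrite pi_pres_mul cats0. Qed.

Lemma pres_mulV : left_inverse pres_one pres_inv pres_mul.
Proof.
elim/pres_group_ind=> u; rewrite pi_pres_inv pi_pres_mul.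
by apply/pres_piP; rewrite -{2}(inv_wordK u); exact: pres_eq_mulwV.
Qed.

Lemma pres_mulrV : right_inverse pres_one pres_inv pres_mul.
Proof.
elim/pres_group_ind=> u; rewrite pi_pres_inv pi_pres_mul.
by apply/pres_piP; exact: pres_eq_mulwV.
Qed.

HB.instance Definition _ := isGroup.Build pres_group
  pres_mulA pres_mul1 pres_mulr1 pres_mulV pres_mulrV.

Lemma pi_presM u v : cls (u ++ v) = cls u * cls v.
Proof. by rewrite -pi_pres_mul. Qed.

End Presentation.

Arguments pres_eq {I} R _ _.

Section UniversalProperty.
Variables (I : choiceType) (R : word I -> word I -> Prop) (G : groupType).
Variable f : I -> G.

Fixpoint word_eval (w : word I) : G :=
  if w is a :: w' then (if a.2 then (f a.1)^-1 else f a.1) * word_eval w'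
  else 1.

Lemma word_eval_cat u v : word_eval (u ++ v) = word_eval u * word_eval v.
Proof. by elim: u => [|a u IHu] /=; rewrite ?mul1g // IHu mulgA. Qed.

Hypothesis fR : forall u v, R u v -> word_eval u = word_eval v.

Lemma word_eval_eq u v : pres_eq R u v -> word_eval u = word_eval v.
Proof.
elim=> {u v} //=.
- by move=> i [] /=; rewrite mulg1 ?mulVg ?mulgV.
- by move=> u u' v v' _ Hu _ Hv; rewrite !word_eval_cat Hu Hv.
- by move=> v u w _ -> _ ->.
Qed.

Definition pres_lift of (forall u v, R u v -> word_eval u = word_eval v) :=
  fun x : pres_group R => word_eval (repr x).

Lemma pres_lift_pi w : pres_lift fR (pres_class R w) = word_eval w.
Proof. exact/word_eval_eq/pres_eq_repr. Qed.

Lemma pres_liftM : {morph pres_lift fR : x y / x * y}.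
Proof.
elim/pres_group_ind=> u; elim/pres_group_ind=> v.
by rewrite -pi_presM !pres_lift_pi word_eval_cat.
Qed.

HB.instance Definition _ :=
  isMultiplicative.Build (pres_group R) G (pres_lift fR) pres_liftM.

End UniversalProperty.

Definition free_group (I : choiceType) : groupType :=
  pres_group (fun _ _ : word I => False).

Section Subgroups.
Variable G : groupType.

Definition subgroup (H : groupClosed G) := {x : G | x \in H}.

HB.instance Definition _ (H : groupClosed G) := SubChoice.on (subgroup H).

Lemma groupClosedP (H : groupClosed G) : group_closed [pred x | x \in H].
Proof. by split=> [|x y]; [exact: gpred1 | exact: gpredF]. Qed.

HB.instance Definition _ (H : groupClosed G) :=
  SubChoice_isSubGroup.Build G _ (subgroup H) (groupClosedP H).

Definition whole : {pred G} := fun=> true.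

HB.instance Definition _ := isMulClosed.Build G whole (fun _ _ _ _ => erefl).
HB.instance Definition _ := isMul1Closed.Build G whole erefl.
HB.instance Definition _ := isInvClosed.Build G whole (fun _ _ => erefl).

Definition center_of (H : {pred G}) : {pred G} :=
  [pred x | (x \in H) && `[< {in H, forall y, commute x y} >]].

Lemma center_ofP (H : {pred G}) x :
  reflect (x \in H /\ {in H, forall y, commute x y}) (x \in center_of H).
Proof.
rewrite [x \in center_of H]inE.
apply: (iffP andP) => -[xH xC]; split => //; exact/asboolP.
Qed.

Section Center.
Variable H : groupClosed G.

Lemma center_of_mul : mulg_closed (center_of H).
Proof.
move=> x y /center_ofP[xH xC] /center_ofP[yH yC]; apply/center_ofP; split.
  exact: gpredM.
move=> z zH; have xz : x * z = z * x := xC z zH.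
have yz : y * z = z * y := yC z zH.
by rewrite /commute -mulgA yz mulgA xz mulgA.
Qed.

Lemma center_of_one : 1 \in center_of H.
Proof.
apply/center_ofP; split=> [|y _]; first exact: gpred1.
by rewrite /commute mulg1 mul1g.
Qed.

Lemma center_of_inv : invg_closed (center_of H).
Proof.
move=> x /center_ofP[xH xC]; apply/center_ofP; split.
  exact: gpredVr.
move=> y yH; have xy : x * y = y * x := xC y yH.
by apply: (mulgI x); rewrite mulVKg mulgA xy mulgK.
Qed.

HB.instance Definition _ := isMulClosed.Build G (center_of H) center_of_mul.
HB.instance Definition _ := isMul1Closed.Build G (center_of H) center_of_one.
HB.instance Definition _ := isInvClosed.Build G (center_of H) center_of_inv.

End Center.

Definition normalises (H N : {pred G}) :=
  forall x y, x \in H -> y \in N -> y ^ x \in N.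

Lemma normalises_center (H : groupClosed G) : normalises H (center_of H).
Proof.
move=> x y xH yZ; have /center_ofP[_ yC] := yZ.
have yx : y * x = x * y := yC x xH.
by rewrite /conjg yx mulKg.
Qed.

Lemma normalises_center_whole (H : {pred G}) :
  normalises H (center_of whole).
Proof. by move=> x y _; exact: normalises_center. Qed.

End Subgroups.

Arguments whole G : clear implicits.
Arguments normalises_center {G} H _ _ _ _.
Arguments normalises_center_whole {G} H _ _ _ _.

Section Kernel.
Variables (G : groupType) (L : groupType) (H : groupClosed G).
Variable f : {multiplicative G -> L}.

Definition kernel_on : {pred G} := [pred x | (x \in H) && (f x == 1)].

Let f1 : f 1 = 1.
Proof. by apply: (mulgI (f 1)); rewrite -gmulfM !mulg1. Qed.

Lemma kernel_on_mul : mulg_closed kernel_on.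
Proof.
move=> x y; rewrite !inE => /andP[xH /eqP fx] /andP[yH /eqP fy].
by rewrite gpredM //= gmulfM fx fy mulg1.
Qed.

Lemma kernel_on_one : 1 \in kernel_on.
Proof. by rewrite inE gpred1 f1 eqxx. Qed.

Lemma kernel_on_inv : invg_closed kernel_on.
Proof.
move=> x; rewrite !inE => /andP[xH /eqP fx].
by apply/andP; rewrite gpredV xH -(mul1g (f _)) -{1}fx -gmulfM mulgV f1.
Qed.

HB.instance Definition _ := isMulClosed.Build G kernel_on kernel_on_mul.
HB.instance Definition _ := isMul1Closed.Build G kernel_on kernel_on_one.
HB.instance Definition _ := isInvClosed.Build G kernel_on kernel_on_inv.

End Kernel.

Section Quotient.
Variables (G : groupType) (H N : groupClosed G).

Definition cosetb : rel (subgroup H) := fun x y => (val x)^-1 * val y \in N.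

Lemma cosetb_refl : reflexive cosetb.
Proof. by move=> x; rewrite /cosetb mulVg gpred1. Qed.

Lemma cosetb_sym : symmetric cosetb.
Proof. by move=> x y; rewrite /cosetb -gpredV invgM invgK. Qed.

Lemma cosetb_trans : transitive cosetb.
Proof.
move=> y x z xy yz; rewrite /cosetb.
by have := gpredM _ _ xy yz; rewrite -mulgA mulKVg.
Qed.

Canonical coset_equiv := EquivRel cosetb cosetb_refl cosetb_sym cosetb_trans.

(* The quotient of [H] by its normal subgroup [N]; when [N] is not included in
   [H], this is the quotient of [H] by the intersection of [H] and [N]. *)
Definition quot_group of normalises H N := {eq_quot coset_equiv}.

Hypothesis nHN : normalises H N.

Local Notation Q := (quot_group nHN).

HB.instance Definition _ := Choice.on Q.

Definition quot_class (x : subgroup H) : Q := \pi_{eq_quot coset_equiv} x.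

Lemma quot_group_ind (P : Q -> Prop) :
  (forall x, P (quot_class x)) -> forall x, P x.
Proof. exact: quotW. Qed.

Lemma quot_classP x y : quot_class x = quot_class y <-> cosetb x y.
Proof. by split=> [/eqquotP|xy]; last exact/eqquotP. Qed.

Lemma cosetb_repr x : cosetb (repr (quot_class x)) x.
Proof. by apply/quot_classP; rewrite /quot_class reprK. Qed.

Definition quot_one : Q := quot_class 1.
Definition quot_mul (x y : Q) : Q := quot_class (repr x * repr y).
Definition quot_inv (x : Q) : Q := quot_class (repr x)^-1.

Lemma quot_mulE x y :
  quot_mul (quot_class x) (quot_class y) = quot_class (x * y).
Proof.
apply/quot_classP; rewrite /cosetb.
move: (cosetb_repr x) (cosetb_repr y); rewrite /cosetb.
move: (repr _) (repr _) => y' x' xx yy; rewrite !gmulfM.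
have := gpredM _ _ (nHN (valP y') xx) yy.
by rewrite /conjg invgM !mulgA mulgK.
Qed.

Lemma quot_invE x : quot_inv (quot_class x) = quot_class x^-1.
Proof.
apply/quot_classP; rewrite /cosetb; have := cosetb_repr x.
rewrite cosetb_sym /cosetb; move: (repr _) => x' xx.
have xVH : (val x)^-1 \in H by apply: gpredVr; exact: valP.
have := nHN xVH xx.
by rewrite /conjg !gmulfV !invgK !mulgA mulgV mul1g.
Qed.

Lemma quot_mulA : associative quot_mul.
Proof.
by elim/quot_group_ind=> x; elim/quot_group_ind=> y; elim/quot_group_ind=> z;
  rewrite !quot_mulE mulgA.
Qed.

Lemma quot_mul1 : left_id quot_one quot_mul.
Proof. by elim/quot_group_ind=> x; rewrite quot_mulE mul1g. Qed.

Lemma quot_mulr1 : right_id quot_one quot_mul.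
Proof. by elim/quot_group_ind=> x; rewrite quot_mulE mulg1. Qed.

Lemma quot_mulV : left_inverse quot_one quot_inv quot_mul.
Proof. by elim/quot_group_ind=> x; rewrite quot_invE quot_mulE mulVg. Qed.

Lemma quot_mulrV : right_inverse quot_one quot_inv quot_mul.
Proof. by elim/quot_group_ind=> x; rewrite quot_invE quot_mulE mulgV. Qed.

HB.instance Definition _ := isGroup.Build Q
  quot_mulA quot_mul1 quot_mulr1 quot_mulV quot_mulrV.

End Quotient.

Arguments quot_group {G} H N _.

Definition gisog (G H : groupType) : Prop :=
  exists f : {multiplicative G -> H}, bijective f.

(* An action of [Q] on [F] by group automorphisms, that is, a homomorphism
   from [Q] to the automorphism group of [F]. *)
Record aut_action (Q F : groupType) := AutAction {
  aut_act :> Q -> F -> F;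
  aut_act1 : forall x, aut_act 1 x = x;
  aut_actM : forall q r x, aut_act (q * r) x = aut_act q (aut_act r x);
  aut_act_mul : forall q x y, aut_act q (x * y) = aut_act q x * aut_act q y
}.

Section SemidirectProduct.
Variables (Q F : groupType) (phi : aut_action Q F).

(* The pair [(x, q)] stands for [x * q], with [F] the normal factor and
   [q x q^-1 = phi q x]. *)
Definition semidirect of aut_action Q F := (F * Q)%type.

Local Notation S := (semidirect phi).

HB.instance Definition _ := Choice.on S.

Definition sd_one : S := (1, 1).
Definition sd_mul (a b : S) : S := (a.1 * phi a.2 b.1, a.2 * b.2).
Definition sd_inv (a : S) : S := (phi a.2^-1 a.1^-1, a.2^-1).

Lemma aut_act_one q : phi q 1 = 1.
Proof. by apply: (mulgI (phi q 1)); rewrite -aut_act_mul !mulg1. Qed.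

Lemma sd_mulA : associative sd_mul.
Proof.
by move=> a b c; rewrite /sd_mul /= aut_act_mul aut_actM !mulgA.
Qed.

Lemma sd_mul1 : left_id sd_one sd_mul.
Proof. by case=> x q; rewrite /sd_mul /= aut_act1 !mul1g. Qed.

Lemma sd_mulr1 : right_id sd_one sd_mul.
Proof. by case=> x q; rewrite /sd_mul /= aut_act_one !mulg1. Qed.

Lemma sd_mulV : left_inverse sd_one sd_inv sd_mul.
Proof.
by case=> x q; rewrite /sd_mul /= -aut_act_mul !mulVg aut_act_one.
Qed.

Lemma sd_mulrV : right_inverse sd_one sd_inv sd_mul.
Proof.
by case=> x q; rewrite /sd_mul /= -aut_actM mulgV aut_act1 mulgV.
Qed.

HB.instance Definition _ := isGroup.Build S
  sd_mulA sd_mul1 sd_mulr1 sd_mulV sd_mulrV.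

End SemidirectProduct.

Section GeneralLinear.
Variables (R : comUnitRingType) (n : nat).

(* ['GL_n[R]] is only available over finite rings. *)
Definition GL := {A : 'M[R]_n | A \in unitmx}.

HB.instance Definition _ := SubChoice.on GL.

Definition GL_one : GL := Sub (1%:M)%R (unitmx1 R n).

Lemma GL_mul_subproof (A B : GL) : (val A *m val B)%R \in unitmx.
Proof. by rewrite unitmx_mul (valP A) (valP B). Qed.

Definition GL_mul (A B : GL) : GL := Sub (val A *m val B)%R (GL_mul_subproof A B).

Lemma GL_inv_subproof (A : GL) : invmx (val A) \in unitmx.
Proof. by rewrite unitmx_inv (valP A). Qed.

Definition GL_inv (A : GL) : GL := Sub (invmx (val A)) (GL_inv_subproof A).

Lemma GL_mulA : associative GL_mul.
Proof. by move=> A B C; apply: val_inj; rewrite /= mulmxA. Qed.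

Lemma GL_mul1 : left_id GL_one GL_mul.
Proof. by move=> A; apply: val_inj; rewrite /= mul1mx. Qed.

Lemma GL_mulr1 : right_id GL_one GL_mul.
Proof. by move=> A; apply: val_inj; rewrite /= mulmx1. Qed.

Lemma GL_mulV : left_inverse GL_one GL_inv GL_mul.
Proof. by move=> A; apply: val_inj; rewrite /= mulVmx ?(valP A). Qed.

Lemma GL_mulrV : right_inverse GL_one GL_inv GL_mul.
Proof. by move=> A; apply: val_inj; rewrite /= mulmxV ?(valP A). Qed.

HB.instance Definition _ := isGroup.Build GL
  GL_mulA GL_mul1 GL_mulr1 GL_mulV GL_mulrV.

End GeneralLinear.

(* Artin's presentation. Strands are numbered from 0 to n - 1, and the
   generator [i] crosses strands [i] and [i + 1]. *)
Inductive braid_rel (n : nat) : word 'I_n.-1 -> word 'I_n.-1 -> Prop :=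
| braid_far (i j : 'I_n.-1) : (i.+1 < j)%N ->
    braid_rel [:: (i, false); (j, false)] [:: (j, false); (i, false)]
| braid_near (i j : 'I_n.-1) : j = i.+1 :> nat ->
    braid_rel [:: (i, false); (j, false); (i, false)]
              [:: (j, false); (i, false); (j, false)].

Definition braid_group (n : nat) : groupType := pres_group (@braid_rel n).

Section Permutation.
Variable n : nat.

Lemma strand_subproof (i : 'I_n.-1) : (i < n)%N /\ (i.+1 < n)%N.
Proof. by have := ltn_ord i; lia. Qed.

Definition lstrand (i : 'I_n.-1) : 'I_n := Ordinal (strand_subproof i).1.
Definition rstrand (i : 'I_n.-1) : 'I_n := Ordinal (strand_subproof i).2.

Definition strand_swap (i : 'I_n.-1) : 'S_n := tperm (lstrand i) (rstrand i).

Lemma strand_swap_rel u v :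
  braid_rel u v -> word_eval strand_swap u = word_eval strand_swap v.
Proof.
have nE (a b : 'I_n) : a <> b :> nat -> a != b.
  by move=> ne; apply/eqP=> e; apply: ne; rewrite e.
case=> {u v} [i j ij|i j ij] /=; rewrite !mulg1.
  suff e : strand_swap i ^ strand_swap j = strand_swap i.
    by apply: (mulgI (strand_swap j)^-1); rewrite mulKg -[RHS]e.
  by rewrite tpermJ !tpermD //; apply: nE => /=; lia.
rewrite [RHS]mulgA; apply: (mulgI (strand_swap j * strand_swap i)^-1).
rewrite [RHS]mulKg -[LHS]/(strand_swap i ^ (strand_swap j * strand_swap i)).
have eij : lstrand j = rstrand i by apply: val_inj; rewrite /= ij.
rewrite tpermJ !permM /strand_swap eij tpermL.
rewrite (tpermD (z := lstrand i)) ?tpermL; try by apply: nE => /=; lia.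
by rewrite (tpermD (z := rstrand j)) //; apply: nE => /=; lia.
Qed.

Definition braid_perm := pres_lift strand_swap_rel.

HB.instance Definition _ := Multiplicative.on braid_perm.

Definition pure_braid : {pred braid_group n} :=
  kernel_on (whole (braid_group n)) braid_perm.

HB.instance Definition _ := GroupClosed.on pure_braid.

End Permutation.

Arguments pure_braid n _ : clear implicits.

Section Burau.
Variables (R : comUnitRingType) (t : R) (n : nat).

Local Open Scope ring_scope.

(* In 1-based notation, the matrix of the i-th generator differs from the
   identity only in its i-th column, whose entries in rows i - 1, i and i + 1
   are t, -t and 1 (rows outside 1, ..., n - 1 being dropped). *)
Definition burau_mx (i : 'I_n.-1) : 'M[R]_n.-1 :=
  \matrix_(j, k)
    if k == i then
      if j.+1 == i :> nat then t
      else if j == i then - t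
      else if j == i.+1 :> nat then 1
      else 0
    else (j == k)%:R.

Definition burau_vec (i : 'I_n.-1) : 'cV[R]_n.-1 :=
  \col_j (if j.+1 == i :> nat then t
          else if j == i then - (1 + t)
          else if j == i.+1 :> nat then 1
          else 0).

Definition burau_pert (i : 'I_n.-1) : 'M[R]_n.-1 :=
  burau_vec i *m delta_mx 0 i.

Lemma burau_mxE i : burau_mx i = 1%:M + burau_pert i.
Proof.
apply/matrixP=> j k; rewrite !mxE big_ord1 !mxE eqxx /=.
case: (altP (k =P i)) => [->|ki]; last by rewrite mulr0 addr0.
rewrite mulr1; case: ifPn => [/eqP ji|_].
  have /negPf -> : j != i by apply/eqP=> e; rewrite e in ji; lia.
  by rewrite add0r.
case: ifPn => _ //=; last by rewrite add0r.
by rewrite opprD addrA subrr add0r.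
Qed.

Lemma burau_pertM i j :
  burau_pert i *m burau_pert j =
  burau_vec j i 0 *: (burau_vec i *m delta_mx 0 j).
Proof.
rewrite /burau_pert mulmxA -(mulmxA (burau_vec i)) -rowE.
rewrite [row _ _]mx11_scalar mxE mul_mx_scalar -scalemxAl.
by [].
Qed.

Lemma burau_pert_far (i j : 'I_n.-1) : (i.+1 < j)%N ->
  burau_pert i *m burau_pert j = 0 /\ burau_pert j *m burau_pert i = 0.
Proof.
move=> ij; have [ne1 ne2] : i != j /\ j != i.
  by split; apply/eqP=> e; rewrite e in ij; lia.
rewrite !burau_pertM !mxE (negPf ne1) (negPf ne2).
by do 4?case: eqP => [?|_]; rewrite ?scale0r //; lia.
Qed.

Lemma burau_pert_sqr i : burau_pert i *m burau_pert i = - (1 + t) *: burau_pert i.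
Proof. by rewrite burau_pertM !mxE eqxx; case: eqP => // ?; lia. Qed.

Lemma burau_pert_near (i j : 'I_n.-1) : j = i.+1 :> nat ->
  burau_pert i *m burau_pert j *m burau_pert i = t *: burau_pert i /\
  burau_pert j *m burau_pert i *m burau_pert j = t *: burau_pert j.
Proof.
move=> ij; have [ne1 ne2] : i != j /\ j != i.
  by split; apply/eqP=> e; rewrite e in ij; lia.
have cji : burau_vec j i 0 = t by rewrite mxE ij eqxx.
have cij : burau_vec i j 0 = 1.
  rewrite mxE (negPf ne2) ij eqxx.
  by case: eqP => [?|//]; lia.
have E (a b c : 'I_n.-1) : burau_pert a *m burau_pert b *m burau_pert c =
    (burau_vec b a 0 * burau_vec c b 0) *: (burau_vec a *m delta_mx 0 c).
  rewrite burau_pertM -scalemxAl -scalerA; congr (_ *: _).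
  rewrite mulmxA -(mulmxA (burau_vec a)) -rowE.
  by rewrite [row _ _]mx11_scalar mxE mul_mx_scalar -scalemxAl.
by rewrite !E cij cji mulr1 mul1r.
Qed.

Lemma burau_mx_far (i j : 'I_n.-1) : (i.+1 < j)%N ->
  burau_mx i *m burau_mx j = burau_mx j *m burau_mx i.
Proof.
move=> /burau_pert_far[ij ji]; rewrite !burau_mxE.
rewrite !mulmxDl !mulmxDr ij ji !mulmx1 !mul1mx !addr0 -!addrA.
by congr (_ + _); rewrite addrC.
Qed.

Lemma burau_mx_near (i j : 'I_n.-1) : j = i.+1 :> nat ->
  burau_mx i *m (burau_mx j *m burau_mx i) =
  burau_mx j *m (burau_mx i *m burau_mx j).
Proof.
move=> /burau_pert_near[]; rewrite !burau_mxE.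
move: (burau_pert_sqr i) (burau_pert_sqr j).
move: (burau_pert i) (burau_pert j) => P Q PP QQ PQP QPQ.
have E (A B : 'M[R]_n.-1) : A *m A = - (1 + t) *: A -> A *m B *m A = t *: A ->
    (1%:M + A) *m ((1%:M + B) *m (1%:M + A)) =
    1%:M + (A + B) + (A *m B + B *m A).
  move=> AA ABA.
  rewrite !(mulmxDl, mulmxDr, mulmx1, mul1mx) mulmxA AA ABA scaleNr scalerDl.
  rewrite scale1r; move: (A *m B) (B *m A) (t *: A) => X Y Z.
  by apply/matrixP=> r c; rewrite !mxE; ring.
rewrite (E P Q) // (E Q P) //; congr (_ + _ + _); exact: addrC.
Qed.

Hypothesis t_unit : t \is a GRing.unit.

Lemma burau_mx_unit i : burau_mx i \in unitmx.
Proof.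
have /mulmx1_unit[] // : burau_mx i *m (1%:M + t^-1 *: burau_pert i) = 1%:M.
rewrite burau_mxE mulmxDl !mulmxDr !mulmx1 mul1mx -scalemxAr burau_pert_sqr.
rewrite scalerA mulrN mulrDr mulr1 mulVr // scaleNr scalerDl scale1r.
move: (burau_pert i) (t^-1 *: _) => P X.
by apply/matrixP=> r c; rewrite !mxE; ring.
Qed.

Definition burau_gen (i : 'I_n.-1) : GL R n.-1 := Sub (burau_mx i) (burau_mx_unit i).

Lemma burau_gen_rel u v :
  braid_rel u v -> word_eval burau_gen u = word_eval burau_gen v.
Proof.
by case=> {u v} [i j ij|i j ij] /=; rewrite !mulg1; apply: val_inj;
  [exact: burau_mx_far | exact: burau_mx_near].
Qed.

End Burau.

(* The reduced Burau representation over any commutative ring with a chosen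
   unit t: taking the ring of Laurent polynomials over the integers gives the
   generic representation, and any other choice gives its specialization. *)
Definition burau (R : comUnitRingType) (t : R) (t_unit : t \is a GRing.unit)
  (n : nat) := pres_lift (burau_gen_rel (n := n) t_unit).

Arguments burau {R t} t_unit n _.

HB.instance Definition _ (R : comUnitRingType) (t : R)
  (t_unit : t \is a GRing.unit) (n : nat) := Multiplicative.on (burau t_unit n).

Definition burau_kernel (n : nat) : {pred braid_group n} :=
  kernel_on (pure_braid n) (burau (unitrN1 int) n).

Arguments burau_kernel n _ : clear implicits.

HB.instance Definition _ (n : nat) := GroupClosed.on (burau_kernel n).

(* Main.v *)
Require Import Defs.
From HB Require Import structures.
From mathcomp Require Import all_boot all_order all_algebra fingroup perm.
From mathcomp Require Import generic_quotient boolp.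
From mathcomp Require Import classical_sets functions cardinality.
From mathcomp Require Import ring zify.

(** Put [n = 2 g + 1].  The braid group on [n + 1] strands acts on the free group
    with generators [X 0, ..., X n], preserving their product, hence on the
    quotient [Fn] by that product, a free group of rank [n]; this action is
    [alpha].  Its restriction to pure braids has as kernel the powers of the full
    twist [delta] (Birman, [kernel_alpha]), and every inner automorphism of [Fn]
    is the action of a braid [push w], which drags the point at infinity around
    the strands.  A pure braid is a product [push w * iota b] with [b] a braid of
    the first [n] strands ([braid_decomposition]).  The faithfulness of Artin's
    action and the determination of the kernel of [alpha] are proved by a common
    induction on the number of strands.

    At [t = -1] the Burau representation is visible on the homomorphisms from
    the free group to the infinite dihedral group that send each generator to a
    reflection: a pure braid belongs to the kernel [K] if and only if it
    preserves the differences of the centres of these reflections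
    ([burau_kernelP]).  This has three consequences.  As [n] is odd, the braids
    of [K] on [n] strands preserve the centres themselves, so they belong to
    [K] on [n + 1] strands.  The braid [push w] belongs to [K] if and only if
    [w] lies in the subgroup [U] of [Fn] that all dihedral homomorphisms kill
    ([kernel_push]).  Finally, each element of [K] on [n + 1] strands is a
    product of a [push w] with [w] in [U], an element of [K] on [n] strands and
    a power of the full twist ([kernel_split]).

    The group [U] is the stabiliser of a point in an infinite set on which [Fn]
    acts with generators acting as involutions, so it is free of infinite rank
    by Schreier's method ([schreier_infinite_rank]).  It meets [K] on [n]
    strands, modulo the full twist, in the powers of the square of the full
    twist on [n] strands, which form the centre of that group.  The quotient by
    this centre lifts back to [K]: the linking number [lam] of the first two
    strands is [1] on the full twist and even on [K], so [unlink], which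
    multiplies [b] by the power [- lam b] of the full twist, maps [K] to itself
    and kills exactly the centre.  Modulo the full twist, [K] on [n + 1] strands
    is therefore the semidirect product of [U] by the image of [unlink].

    Both centres follow from one fact ([abelian_normalised_by_push]): since a
    free group of rank at least two has no non-trivial abelian normal subgroup,
    an abelian set of pure braids that [push] normalises consists of powers of
    the full twist. *)

Set Implicit Arguments.
Unset Strict Implicit.
Unset Printing Implicit Defensive.

Import Order.TTheory GRing.Theory.

Local Open Scope group_scope.

(** * Free groups and their reduced words *)

Section MultiplicativeTheory.
Variables (G H : groupType) (f : {multiplicative G -> H}).

Lemma mmorph1 : f 1 = 1.
Proof. by apply: (mulgI (f 1)); rewrite -gmulfM !mulg1. Qed.

Lemma mmorphV x : f x^-1 = (f x)^-1.
Proof. by apply: (mulgI (f x)); rewrite -gmulfM !mulgV mmorph1. Qed.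

Lemma mmorphJ x y : f (x ^ y) = f x ^ f y.
Proof. by rewrite /conjg !gmulfM mmorphV. Qed.

Lemma mmorphX x n : f (x ^+ n) = f x ^+ n.
Proof. by elim: n => [|n IHn]; rewrite ?mmorph1 // !expgS gmulfM IHn. Qed.

End MultiplicativeTheory.

Section IntegerPowers.
Variable G : groupType.
Implicit Type x : G.

Definition zpow x (k : int) : G :=
  match k with Posz n => x ^+ n | Negz n => (x ^+ n.+1)^-1 end.

Lemma zpowN x k : zpow x (- k)%R = (zpow x k)^-1.
Proof. by case: k => [[|n]|n] /=; rewrite ?invg1 ?invgK. Qed.

Lemma zpowS x (k : int) : zpow x (1 + k)%R = x * zpow x k.
Proof.
case: k => [n|[|n]].
- by rewrite -PoszD add1n /= expgS.
- by rewrite /= mulgV.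
have -> : (1 + Negz n.+1)%R = Negz n by lia.
by rewrite /= [in RHS]expgSr invgM mulVKg.
Qed.

Lemma zpowD x k l : zpow x (k + l)%R = zpow x k * zpow x l.
Proof.
have pos n m : zpow x (Posz n + m)%R = zpow x n * zpow x m.
  elim: n => [|n IHn]; first by rewrite add0r mul1g.
  by rewrite -add1n PoszD -addrA !zpowS IHn mulgA.
case: k => n; first exact: pos.
apply: (mulgI (zpow x n.+1)); rewrite -pos mulgA mulgV mul1g.
by congr (zpow _ _); lia.
Qed.

Lemma zpow_double x k : zpow x (k + k)%R = zpow (x * x) k.
Proof.
rewrite zpowD; case: k => n /=.
  by rewrite expgMn.
by rewrite -invgM -expgMn.
Qed.

Lemma commute_zpow x y k : commute x y -> commute x (zpow y k).
Proof. by case: k => n c; [|apply: commuteV]; exact: commuteX. Qed.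

Lemma zpow_closed (S : groupClosed G) x k : x \in S -> zpow x k \in S.
Proof. by case: k => n xS; rewrite /= ?gpredV; exact: gpredXn. Qed.

End IntegerPowers.

Lemma zpow_morph (G H : groupType) (f : {multiplicative G -> H}) x k :
  f (zpow x k) = zpow (f x) k.
Proof. by case: k => n /=; rewrite ?mmorphV mmorphX. Qed.

Section PresentedGenerators.
Variables (I : choiceType) (R : word I -> word I -> Prop).
Implicit Types (u v : word I) (i : I).

Definition pgen i : pres_group R := pres_class R [:: (i, false)].

Lemma pres_class_nil : pres_class R [::] = 1. Proof. by []. Qed.

Lemma pres_classV i : pres_class R [:: (i, true)] = (pgen i)^-1.
Proof.
by apply: (mulgI (pgen i)); rewrite mulgV -pi_presM; apply/pres_piP/pres_eq_cancel.
Qed.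

Lemma pres_class_cons i b u :
  pres_class R ((i, b) :: u) =
  (if b then (pgen i)^-1 else pgen i) * pres_class R u.
Proof. by rewrite -cat1s pi_presM; case: b; rewrite ?pres_classV. Qed.

Lemma pgen_ind (P : pres_group R -> Prop) : P 1 ->
  (forall i x, P x -> P (pgen i * x)) ->
  (forall i x, P x -> P ((pgen i)^-1 * x)) -> forall x, P x.
Proof.
move=> P1 Pg PV; elim/pres_group_ind; elim=> [|[i b] u IHu] //.
by rewrite pres_class_cons; case: b; [apply: PV | apply: Pg].
Qed.

Lemma pgen_ind_r (P : pres_group R -> Prop) : P 1 ->
  (forall i x, P x -> P (x * pgen i)) ->
  (forall i x, P x -> P (x * (pgen i)^-1)) -> forall x, P x.
Proof.
move=> P1 Pg PV; elim/pres_group_ind; elim/last_ind=> [|u [i b] IHu] //.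
by rewrite -cats1 pi_presM; case: b; rewrite ?pres_classV; [apply: PV | apply: Pg].
Qed.

Lemma pres_lift_gen (G : groupType) (f : I -> G)
    (fR : forall u v, R u v -> word_eval f u = word_eval f v) i :
  pres_lift fR (pgen i) = f i.
Proof. by rewrite pres_lift_pi /= mulg1. Qed.

Lemma pres_morph_eq (G : groupType) (f g : {multiplicative pres_group R -> G}) :
  (forall i, f (pgen i) = g (pgen i)) -> f =1 g.
Proof.
by move=> fg; elim/pgen_ind => [|i x IH|i x IH]; rewrite ?mmorph1 // !gmulfM ?mmorphV IH fg.
Qed.

End PresentedGenerators.

Section PresentedAction.
Variables (I : choiceType) (R : word I -> word I -> Prop) (T : Type).
Variable f : I -> bool -> T -> T.

Definition word_act (u : word I) (x : T) : T := foldl (fun y a => f a.1 a.2 y) x u.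

Lemma word_act_cat u v x : word_act (u ++ v) x = word_act v (word_act u x).
Proof. exact: foldl_cat. Qed.

Hypothesis fK : forall i b x, f i (~~ b) (f i b x) = x.
Hypothesis fR : forall u v, R u v -> word_act u =1 word_act v.

Lemma word_act_eq u v : pres_eq R u v -> word_act u =1 word_act v.
Proof.
elim=> {u v} //=.
- by move=> u u' v v' _ Hu _ Hv x; rewrite !word_act_cat Hu Hv.
- by move=> u v _ H x; rewrite H.
- by move=> v u w _ Hu _ Hv x; rewrite Hu.
Qed.

Definition pres_act of (forall i b x, f i (~~ b) (f i b x) = x) &
    (forall u v, R u v -> word_act u =1 word_act v) :=
  fun (x : T) (g : pres_group R) => word_act (repr g) x.

Local Notation act := (pres_act fK fR).

Lemma pres_act_pi u x : act x (pres_class R u) = word_act u x.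
Proof. exact/word_act_eq/pres_eq_repr. Qed.

Lemma pres_act1 x : act x 1 = x.
Proof. exact: (pres_act_pi [::]). Qed.

Lemma pres_actM x g h : act x (g * h) = act (act x g) h.
Proof.
move: g h; elim/pres_group_ind=> u; elim/pres_group_ind=> v.
by rewrite -pi_presM !pres_act_pi word_act_cat.
Qed.

Lemma pres_act_gen x i : act x (pgen R i) = f i false x.
Proof. exact: pres_act_pi. Qed.

Lemma pres_act_genV x i : act x (pgen R i)^-1 = f i true x.
Proof. by rewrite -pres_classV pres_act_pi. Qed.

End PresentedAction.

Section FreeGroup.
Variable I : choiceType.
Local Notation F := (free_group I).

Definition fgen (i : I) : F := pgen _ i.

Section Lift.
Variables (G : groupType) (f : I -> G).

Lemma free_no_rel (u v : word I) : False -> word_eval f u = word_eval f v.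
Proof. by []. Qed.

Definition flift : F -> G := pres_lift free_no_rel.

HB.instance Definition _ := Multiplicative.on flift.

Lemma flift_gen i : flift (fgen i) = f i.
Proof. exact: pres_lift_gen. Qed.

End Lift.

Lemma fgen_ind (P : F -> Prop) : P 1 ->
  (forall i x, P x -> P (fgen i * x)) ->
  (forall i x, P x -> P ((fgen i)^-1 * x)) -> forall x, P x.
Proof. exact: pgen_ind. Qed.

Lemma free_morph_eq (G : groupType) (f g : {multiplicative F -> G}) :
  (forall i, f (fgen i) = g (fgen i)) -> f =1 g.
Proof. exact: pres_morph_eq. Qed.

Definition linv (a : I * bool) := (a.1, ~~ a.2).

Lemma linvK : involutive linv. Proof. by case=> i b; rewrite /linv /= negbK. Qed.

Definition no_cancel : rel (I * bool) := fun a b => b != linv a.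

Definition reduced (w : word I) := sorted no_cancel w.

Definition red_cons (a : I * bool) (w : word I) : word I :=
  if w is b :: w' then if b == linv a then w' else a :: w else [:: a].

Lemma red_cons_reduced a w : reduced w -> reduced (red_cons a w).
Proof.
case: w => //= b w rw; case: ifPn => ba; last by rewrite /= /no_cancel ba.
exact: path_sorted rw.
Qed.

Lemma red_consK a w : reduced w -> red_cons (linv a) (red_cons a w) = w.
Proof.
case: w => [_|b w rw] /=; first by rewrite linvK eqxx.
case: ifPn => [/eqP eb|ba] /=; last by rewrite linvK eqxx.
rewrite eb {b eb} in rw *; case: w rw => //= c w /andP[/negPf].
by rewrite /no_cancel => -> _.
Qed.

Definition red (w : word I) : word I := foldr red_cons [::] w.

Lemma foldr_red_reduced w r : reduced r -> reduced (foldr red_cons r w).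
Proof. by elim: w => //= a w IHw /IHw; apply: red_cons_reduced. Qed.

Lemma red_reduced w : reduced (red w).
Proof. exact: foldr_red_reduced. Qed.

Lemma red_id w : reduced w -> red w = w.
Proof.
elim: w => //= a w IHw aw; rewrite IHw; last exact: path_sorted aw.
by case: w aw {IHw} => //= b w /andP[/negPf]; rewrite /no_cancel => ->.
Qed.

(** Prefixing a letter with cancellation acts on reduced words, and opposite
    letters act by inverse maps; hence equivalent words have the same
    reduction, and reduced words are normal forms. *)
Lemma pres_eq_red u v :
  pres_eq (fun _ _ : word I => False) u v -> red u = red v.
Proof.
rewrite /red => uv; have: reduced [::] by []; move: [::] => r; move: r.
elim: uv => {u v} //=.
- by move=> i b r rr; have := red_consK (i, ~~ b) rr; rewrite /linv /= negbK.
- move=> u u' v v' _ Hu _ Hv r rr.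
  by rewrite !foldr_cat Hv // Hu // foldr_red_reduced.
- by move=> u v _ H r rr; rewrite H.
- by move=> v u w _ Hu _ Hv r rr; rewrite Hu // Hv.
Qed.

Local Notation cls := (pres_class (fun _ _ : word I => False)).

Definition letter (a : I * bool) : F := if a.2 then (fgen a.1)^-1 else fgen a.1.

Lemma free_class_cons a w : cls (a :: w) = letter a * cls w.
Proof. by case: a => i b; exact: pres_class_cons. Qed.

Lemma free_class1 a : cls [:: a] = letter a.
Proof. by rewrite free_class_cons pres_class_nil mulg1. Qed.

Lemma letterV a : (letter a)^-1 = letter (linv a).
Proof. by case: a => i [] /=; rewrite /letter /= ?invgK. Qed.

Definition nf (x : F) : word I := red (repr x).

Lemma nf_class w : nf (cls w) = red w.
Proof. exact/pres_eq_red/pres_eq_repr. Qed.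

Lemma free_reduced_inj u v : reduced u -> reduced v -> cls u = cls v -> u = v.
Proof. by move=> ru rv /(congr1 nf); rewrite !nf_class !red_id. Qed.

Lemma class_red_cons a w : cls (red_cons a w) = letter a * cls w.
Proof.
case: w => [|b w] /=; first by rewrite free_class1 pres_class_nil mulg1.
case: eqP => [->|_]; last by rewrite free_class_cons.
by rewrite (free_class_cons (linv a)) -letterV mulKVg.
Qed.

Lemma class_red w : cls (red w) = cls w.
Proof. by elim: w => //= a w IHw; rewrite class_red_cons IHw free_class_cons. Qed.

Lemma nfK x : cls (nf x) = x.
Proof. by rewrite /nf class_red; exact: reprK. Qed.

Lemma nf_reduced x : reduced (nf x).
Proof. exact: red_reduced. Qed.

Lemma free_class_cat u v : cls (u ++ v) = cls u * cls v.
Proof. exact: pi_presM. Qed.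

Lemma free_gen_cons i w : cls ((i, false) :: w) = fgen i * cls w.
Proof. exact: free_class_cons. Qed.

(** A reduced word that commutes with a generator [x] and starts with another
    letter is empty: both [x w] and, up to a final cancellation, [w x] are
    reduced, so they can only agree if [w] starts with [x].  Stripping initial
    powers of [x] gives the general case. *)
Lemma centraliser_fgen i x : commute x (fgen i) -> exists k, x = zpow (fgen i) k.
Proof.
rewrite -(nfK x); move: (nf_reduced x); move: (nf x) => w.
elim: w => [|[j b] w IHw] rw cx; first by exists 0%R.
have [ji|nji] := eqVneq j i.
  subst j; rewrite free_class_cons /letter /= in cx *.
  have [] := IHw (path_sorted rw).
    rewrite /commute; apply: (mulgI (letter (i, b))); rewrite /letter /=.
    rewrite mulgA cx; case: (b) => //.
    by rewrite !mulgA mulgV mulVg.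
  move=> k ->; case: b {rw cx} => /=.
    by exists (- 1 + k)%R; rewrite zpowD zpowN.
  by exists (1 + k)%R; rewrite zpowD.
have r1 : reduced ((i, false) :: (j, b) :: w).
  apply/andP; split; last exact: rw.
  by apply/eqP => -[e]; rewrite e eqxx in nji.
have e1 : cls ((i, false) :: (j, b) :: w) = cls (rcons ((j, b) :: w) (i, false)).
  by rewrite free_class_cons -cats1 pi_presM free_class1; exact: esym.
have := congr1 nf e1; rewrite !nf_class (red_id r1).
have := red_reduced (rcons ((j, b) :: w) (i, false)).
case/lastP: w => [|w [k c]] in rw r1 {e1 IHw cx} *.
  have r2 : reduced (rcons [:: (j, b)] (i, false)).
    rewrite /= andbT /no_cancel; apply/eqP => -[] e.
    by rewrite e eqxx in nji.
  by rewrite red_id // => _ [e]; rewrite e eqxx in nji.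
have [e|ne] := eqVneq (i, false) (linv (k, c)).
  have -> : red (rcons ((j, b) :: rcons w (k, c)) (i, false)) = (j, b) :: w.
    apply: free_reduced_inj; first exact: red_reduced.
      by move: rw; rewrite /reduced /= rcons_path => /andP[].
    rewrite class_red -rcons_cons -!cats1 -!catA !pi_presM !free_class1 e -letterV.
    by rewrite mulgV mulg1.
  by move=> _ /(congr1 size) /=; rewrite size_rcons; lia.
rewrite red_id; first by move=> _ [e]; rewrite e eqxx in nji.
move: rw; rewrite /reduced /= !rcons_path last_rcons => -> /=.
by rewrite /no_cancel ne.
Qed.

(** In a free group of rank at least two, conjugating [t] by a generator that
    occurs neither at the beginning nor at the end of its reduced word gives
    an element that does not commute with [t]; a preliminary conjugation makes
    such a generator available. *)
Lemma commute_conjugates_trivial (i j : I) (t : F) : i != j ->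
  (forall v, commute t (t ^ v)) -> t = 1.
Proof.
move=> ij ct; apply: contrapT => t1.
have ctJ u v : commute (t ^ u) ((t ^ u) ^ v).
  have c : t * t ^ (u * v * u^-1) = t ^ (u * v * u^-1) * t by exact: ct.
  have : (t * t ^ (u * v * u^-1)) ^ u = (t ^ (u * v * u^-1) * t) ^ u by rewrite c.
  by rewrite conjMg [in RHS]conjMg -!conjgM mulgVK.
have bad (p q : I * bool) w (k : I) u : cls (p :: w) = t ^ u -> reduced (p :: w) ->
    last p w = q -> k != p.1 -> k != q.1 -> False.
  set r := p :: w => er rr lq kp kq.
  have := ctJ u (fgen k)^-1; rewrite -er /conjg invgK => c.
  have /free_reduced_inj e : cls (r ++ (k, false) :: r ++ [:: (k, true)]) =
           cls ((k, false) :: r ++ (k, true) :: r).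
    rewrite free_class_cat free_class_cons free_class_cat free_class1 c.
    by rewrite [RHS]free_class_cons free_class_cat free_class_cons !mulgA.
  have npk b : no_cancel (k, b) p.
    by apply/eqP => epk; rewrite epk eqxx in kp.
  have nqk b : no_cancel q (k, b).
    by apply/eqP => -[ekq _]; rewrite ekq eqxx in kq.
  have rw : path no_cancel p w by [].
  have [] // : (k, false) = p /\ True.
    suff [-> //] : r ++ (k, false) :: r ++ [:: (k, true)] =
        (k, false) :: r ++ (k, true) :: r.
    apply: e; rewrite /reduced /r /= !cat_path /= ?lq ?npk ?nqk ?rw //=.
    by rewrite cat_path /= rw lq nqk.
  by move=> epk; rewrite -epk eqxx in kp.
have: nf t <> [::] by move=> e; apply: t1; rewrite -(nfK t) e.
case e: (nf t) (nf_reduced t) => [|p w] // rpw _.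
have et : cls (p :: w) = t by rewrite -e nfK.
set q := last p w.
have [pq|pq] := eqVneq p.1 q.1.
  have [ip|ip] := eqVneq i p.1.
    apply: (bad p q w j 1); rewrite ?conjg1 // -?pq -ip eq_sym //.
  by apply: (bad p q w i 1); rewrite ?conjg1 // -?pq.
have er : cls (linv q :: p :: w ++ [:: q]) = t ^ letter q.
  by rewrite free_class_cons -cat_cons free_class_cat free_class1 et -letterV.
have rr : reduced (linv q :: p :: w ++ [:: q]).
  rewrite /= cat_path /= -/q; apply/and4P; split=> //.
    by rewrite /no_cancel linvK; apply: contra pq => /eqP ->.
  by apply/eqP => /(congr1 snd) /=; case: (q.2).
have lq : last (linv q) (p :: w ++ [:: q]) = q by rewrite /= last_cat.
have [iq|iq] := eqVneq i q.1.
  by apply: (bad _ _ _ j _ er rr lq); rewrite /= -iq eq_sym.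
by apply: (bad _ _ _ i _ er rr lq).
Qed.

Corollary free_centre_trivial (i j : I) (t : F) : i != j ->
  (forall v, commute t v) -> t = 1.
Proof. by move=> ij ct; apply: (commute_conjugates_trivial ij) => v. Qed.

Lemma fgen_zpow_inj (i : I) k : zpow (fgen i) k = 1 -> k = 0%R.
Proof.
have nfX n : nf (fgen i ^+ n) = nseq n (i, false).
  rewrite -[RHS]red_id; last first.
    elim: n => // -[|n] //= IHn; rewrite IHn andbT.
    by rewrite /no_cancel; apply/eqP => -[].
  rewrite -nf_class; congr nf; elim: n => // n IHn.
  by rewrite expgS IHn /= free_gen_cons.
have nf1 : nf 1 = [::] by rewrite -(pres_class_nil (fun _ _ => False)) nf_class.
case: k => n /=; first by move=> e; have := nfX n; rewrite e nf1; case: n {e}.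
by move=> /eqP; rewrite invg_eq1 => /eqP e; have := nfX n.+1; rewrite e nf1.
Qed.

End FreeGroup.

(** * The Artin action and relations between turns of strands *)

Section GroupIdentities.
Variable G : groupType.
Implicit Types x y z : G.

Lemma conjg_conj x y z : (x ^ y) ^ (z ^ y) = (x ^ z) ^ y.
Proof. by rewrite -conjJg. Qed.

Lemma commute_conj x y : commute x y -> x ^ y = x.
Proof. by move=> c; rewrite conjgE c mulKg. Qed.

Lemma commuteJ x y z : commute x y -> commute (x ^ z) (y ^ z).
Proof. by move=> c; rewrite /commute -!conjMg c. Qed.

Lemma commuteMl x y z : commute x z -> commute y z -> commute (x * y) z.
Proof. by move=> cx cy; apply/commute_sym/commuteM; apply: commute_sym. Qed.

Lemma pair_comm t w x : t = x * w * x -> commute t w -> commute (t * t ^ x) x.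
Proof.
move=> et c; have kx : commute (t * w) x.
  by rewrite /commute [in RHS]c et !mulgA.
have -> : t * t ^ x = x * (t * w) * x.
  by rewrite c conjgE !mulgA; congr (_ * _ * _); rewrite {1}et mulgK.
by apply: commuteMl (commute_refl _); apply: commuteMl kx; apply: commute_refl.
Qed.

Lemma braid_conj x y : x * y * x = y * x * y -> x ^ (y * x) = y.
Proof. by move=> e; rewrite conjgE (mulgA x) e mulKg. Qed.

End GroupIdentities.

Local Notation F := (free_group nat).
Local Notation X := (@fgen nat).

(** All braid groups act on one free group of countable rank, so that adding a
    strand does not change the action: the generator [i] only moves [X i] and
    [X i.+1], and it preserves their product. *)
Definition artin_img (i j : nat) : F :=
  if j == i then X i.+1 else if j == i.+1 then X i ^ X i.+1 else X j.

Definition artin_imgV (i j : nat) : F :=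
  if j == i then X i.+1 ^ (X i)^-1 else if j == i.+1 then X i else X j.

Definition artin_letter (i : nat) (b : bool) : F -> F :=
  flift (if b then artin_imgV i else artin_img i).

HB.instance Definition _ i b := Multiplicative.on (artin_letter i b).

Lemma artin_letterM i b x y :
  artin_letter i b (x * y) = artin_letter i b x * artin_letter i b y.
Proof. exact: gmulfM. Qed.
Lemma artin_letterV i b x : artin_letter i b x^-1 = (artin_letter i b x)^-1.
Proof. exact: mmorphV. Qed.
Lemma artin_letterJ i b x y :
  artin_letter i b (x ^ y) = artin_letter i b x ^ artin_letter i b y.
Proof. exact: mmorphJ. Qed.

Section ArtinLetters.
Variable i : nat.

Lemma artin_l : artin_letter i false (X i) = X i.+1.
Proof. by rewrite /artin_letter flift_gen /artin_img eqxx. Qed.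

Lemma artin_r : artin_letter i false (X i.+1) = X i ^ X i.+1.
Proof. by rewrite /artin_letter flift_gen /artin_img gtn_eqF // eqxx. Qed.

Lemma artin_lV : artin_letter i true (X i) = X i.+1 ^ (X i)^-1.
Proof. by rewrite /artin_letter flift_gen /artin_imgV eqxx. Qed.

Lemma artin_rV : artin_letter i true (X i.+1) = X i.
Proof. by rewrite /artin_letter flift_gen /artin_imgV gtn_eqF // eqxx. Qed.

Lemma artin_o b j : j != i -> j != i.+1 -> artin_letter i b (X j) = X j.
Proof.
by move=> /negPf ji /negPf ji1; case: b;
  rewrite /artin_letter flift_gen /artin_img /artin_imgV ji ji1.
Qed.

Lemma artin_letterK b x : artin_letter i (~~ b) (artin_letter i b x) = x.
Proof.
have := @free_morph_eq _ _ (artin_letter i (~~ b) \o artin_letter i b) idfun.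
apply=> j /=; have [->|ji] := eqVneq j i.
  case: b => /=; first by rewrite artin_lV artin_letterJ artin_letterV artin_l artin_r conjgK.
  by rewrite artin_l artin_rV.
have [->|ji1] := eqVneq j i.+1.
  case: b => /=; first by rewrite artin_rV artin_l.
  by rewrite artin_r artin_letterJ artin_lV artin_rV conjgKV.
by rewrite !artin_o.
Qed.

End ArtinLetters.

Lemma artin_far i j : (i.+1 < j)%N -> forall x,
  artin_letter j false (artin_letter i false x) =
  artin_letter i false (artin_letter j false x).
Proof.
move=> ij; have := @free_morph_eq _ _ (artin_letter j false \o artin_letter i false)
  (artin_letter i false \o artin_letter j false).
apply=> k /=; have [->|k1] := eqVneq k i.
  by rewrite artin_l !(@artin_o j) ?artin_l //; lia.
have [->|k2] := eqVneq k i.+1.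
  rewrite artin_r artin_letterJ !(@artin_o j); try lia.
  by rewrite artin_r.
have [->|k3] := eqVneq k j.
  by rewrite artin_l !(@artin_o i) ?artin_l //; lia.
have [->|k4] := eqVneq k j.+1.
  rewrite artin_r artin_letterJ !(@artin_o i); try lia.
  by rewrite artin_r.
by rewrite !artin_o.
Qed.

Lemma artin_near i x :
  artin_letter i false (artin_letter i.+1 false (artin_letter i false x)) =
  artin_letter i.+1 false (artin_letter i false (artin_letter i.+1 false x)).
Proof.
have := @free_morph_eq _ _
  (artin_letter i false \o (artin_letter i.+1 false \o artin_letter i false))
  (artin_letter i.+1 false \o (artin_letter i false \o artin_letter i.+1 false)).
apply=> k /=; have [->|k1] := eqVneq k i.
  rewrite !artin_l (@artin_o i.+1 _ i); try lia.
  by rewrite (@artin_o i _ i.+2) ?artin_l //; lia.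
have [->|k2] := eqVneq k i.+1.
  rewrite artin_r artin_l artin_letterJ artin_l (@artin_o i.+1 _ i); try lia.
  rewrite artin_letterJ artin_l (@artin_o i _ i.+2); try lia.
  by rewrite artin_r.
have [->|k3] := eqVneq k i.+2.
  rewrite artin_r (@artin_o i _ i.+2); try lia.
  rewrite artin_r !artin_letterJ artin_r (@artin_o i _ i.+2); try lia.
  rewrite artin_letterJ artin_r artin_l (@artin_o i.+1 _ i); try lia.
  by rewrite conjg_conj.
by rewrite !artin_o.
Qed.

Section ArtinAction.
Variable n : nat.

Let f (i : 'I_n.-1) b : F -> F := artin_letter i b.

Lemma artin_fK (i : 'I_n.-1) b x : f i (~~ b) (f i b x) = x.
Proof. exact: artin_letterK. Qed.

Lemma artin_fR u v : @braid_rel n u v -> word_act f u =1 word_act f v.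
Proof.
case=> {u v} i j ij x /=; first exact: artin_far.
by rewrite /f ij; exact: artin_near.
Qed.

Definition artin (x : F) (b : braid_group n) : F := pres_act artin_fK artin_fR x b.

Lemma artin_act1 x : artin x 1 = x.
Proof. exact: pres_act1. Qed.

Lemma artin_actM x b c : artin x (b * c) = artin (artin x b) c.
Proof. exact: pres_actM. Qed.

Definition artin_by (b : braid_group n) (x : F) := artin x b.

Lemma artin_byM b : {morph artin_by b : x y / x * y}.
Proof.
move=> x y; rewrite /artin_by; elim/pgen_ind_r: b => [|i b IHb|i b IHb].
- by rewrite !artin_act1.
- by rewrite !artin_actM IHb /artin !pres_act_gen /f gmulfM.
- by rewrite !artin_actM IHb /artin !pres_act_genV /f gmulfM.
Qed.

HB.instance Definition _ b := isMultiplicative.Build F F (artin_by b) (artin_byM b).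

Lemma artinM x y b : artin (x * y) b = artin x b * artin y b.
Proof. exact: (artin_byM b). Qed.
Lemma artin1 b : artin 1 b = 1.
Proof. exact: (mmorph1 (artin_by b)). Qed.
Lemma artinV x b : artin x^-1 b = (artin x b)^-1.
Proof. exact: (mmorphV (artin_by b)). Qed.
Lemma artinJ x y b : artin (x ^ y) b = artin x b ^ artin y b.
Proof. exact: (mmorphJ (artin_by b)). Qed.

Lemma artinK x b : artin (artin x b) b^-1 = x.
Proof. by rewrite -artin_actM mulgV artin_act1. Qed.
Lemma artinVK x b : artin (artin x b^-1) b = x.
Proof. by rewrite -artin_actM mulVg artin_act1. Qed.

End ArtinAction.

Local Notation "x |> b" := (artin x b) (at level 33, left associativity).

Fixpoint xi (n : nat) : F := if n is k.+1 then xi k * X k else 1.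

Lemma artin_letter_xi i b n : n != i.+1 -> artin_letter i b (xi n) = xi n.
Proof.
have low m : (m <= i)%N -> artin_letter i b (xi m) = xi m.
  elim: m => [|m IHm] mi /=; first exact: mmorph1.
  by rewrite artin_letterM IHm ?artin_o //; lia.
have [/low //|] := leqP n i.
rewrite leq_eqVlt eq_sym => /orP[-> //|] ni _.
rewrite -(subnK ni); elim: (n - i.+2)%N => [|d IHd]; last first.
  by rewrite addSn /= artin_letterM IHd artin_o //; lia.
rewrite add0n /= !artin_letterM low // -!mulgA; congr (_ * _).
case: (b); last by rewrite artin_l artin_r -conjgC.
by rewrite artin_lV artin_rV conjgE invgK !mulgA mulgVK.
Qed.

(** The index is a natural number, so that inductions need no bound proofs;
    out of range the value is the neutral element.  The index [n] counts the
    generators: the braids have [n.+1] strands. *)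
Definition sig n (i : nat) : braid_group n.+1 :=
  if insub i is Some j then pgen (@braid_rel n.+1) (j : 'I_n) else 1.

Section Sigma.
Variable n : nat.
Local Notation s := (sig n).

Lemma sig_ord (i : 'I_n) : s i = pgen (@braid_rel n.+1) i.
Proof. by rewrite /sig valK. Qed.

Lemma sigE i (h : (i < n)%N) : s i = pgen (@braid_rel n.+1) (Ordinal h).
Proof. exact: (sig_ord (Ordinal h)). Qed.

Lemma sig_far i j : (i.+1 < j)%N -> (j < n)%N -> commute (s i) (s j).
Proof.
move=> ij jn; have hi : (i < n)%N by lia.
rewrite (sigE hi) (sigE jn) /commute -!pi_presM.
apply/pres_piP/pres_eq_rel/braid_far; exact: ij.
Qed.

Lemma sig_near i : (i.+1 < n)%N -> s i * s i.+1 * s i = s i.+1 * s i * s i.+1.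
Proof.
move=> h; have hi : (i < n)%N by lia.
rewrite (sigE hi) (sigE h).
have /pres_piP := pres_eq_rel (@braid_near n.+1 (Ordinal hi) (Ordinal h) erefl).
by rewrite !pres_class_cons pres_class_nil !mulg1 !mulgA.
Qed.

Lemma sig_ind (P : braid_group n.+1 -> Prop) : P 1 ->
  (forall i x, (i < n)%N -> P x -> P (x * s i)) ->
  (forall i x, (i < n)%N -> P x -> P (x * (s i)^-1)) -> forall x, P x.
Proof.
move=> P1 Pg PV; elim/pgen_ind_r=> // i x Px.
  by rewrite -sig_ord; apply: Pg.
by rewrite -sig_ord; apply: PV.
Qed.

Lemma artin_sig x i : (i < n)%N -> x |> s i = artin_letter i false x.
Proof. by move=> h; rewrite (sigE h) /artin pres_act_gen. Qed.

Lemma artin_sigV x i : (i < n)%N -> x |> (s i)^-1 = artin_letter i true x.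
Proof. by move=> h; rewrite (sigE h) /artin pres_act_genV. Qed.

Lemma artin_high (b : braid_group n.+1) j : (n < j)%N -> X j |> b = X j.
Proof.
move=> nj; elim/sig_ind: b => [|i b h IHb|i b h IHb]; first exact: artin_act1.
  by rewrite artin_actM IHb artin_sig // artin_o //; lia.
by rewrite artin_actM IHb artin_sigV // artin_o //; lia.
Qed.

Lemma artin_xi (b : braid_group n.+1) m : (n < m)%N -> xi m |> b = xi m.
Proof.
move=> nm; elim/sig_ind: b => [|i b h IHb|i b h IHb]; first exact: artin_act1.
  by rewrite artin_actM IHb artin_sig // artin_letter_xi //; lia.
by rewrite artin_actM IHb artin_sigV // artin_letter_xi //; lia.
Qed.

Fixpoint up k := if k is j.+1 then up j * s j else 1.
Fixpoint down k := if k is j.+1 then s j * down j else 1.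

Lemma up_comm k j : (k < j)%N -> (j < n)%N -> commute (up k) (s j).
Proof.
elim: k => [|k IHk] kj jn /=; first exact/commute_sym/commute1.
by apply: commuteMl; [apply: IHk; lia | apply: sig_far; lia].
Qed.

Lemma down_comm k j : (k < j)%N -> (j < n)%N -> commute (down k) (s j).
Proof.
elim: k => [|k IHk] kj jn /=; first exact/commute_sym/commute1.
by apply: commuteMl; [apply: sig_far; lia | apply: IHk; lia].
Qed.

Lemma up_shift k j : (j.+1 < k)%N -> (k <= n)%N -> s j.+1 * up k = up k * s j.
Proof.
move=> jk; rewrite -(subnK jk); elim: (k - j.+2)%N => [|d IHd] kn.
  rewrite add0n /= !mulgA -(up_comm (k := j)) //; try lia.
  by rewrite -!mulgA; congr (_ * _); rewrite !mulgA sig_near //; lia.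
rewrite addSn /= !mulgA IHd -?mulgA; try lia.
by congr (_ * _); apply: sig_far; lia.
Qed.

Lemma down_shift k j : (j.+1 < k)%N -> (k <= n)%N -> down k * s j.+1 = s j * down k.
Proof.
move=> jk; rewrite -(subnK jk); elim: (k - j.+2)%N => [|d IHd] kn.
  rewrite add0n /= -!mulgA (down_comm (k := j)) //; try lia.
  by rewrite !mulgA; congr (_ * _); rewrite sig_near //; lia.
rewrite addSn /= -!mulgA IHd; try lia.
by rewrite !mulgA; congr (_ * _); apply/commute_sym/sig_far; lia.
Qed.

(** The braid in which the strand [i] makes a full turn around all others. *)
Fixpoint turn i := if i is j.+1 then turn j ^ s j else up n * down n.

(** Moving [sig n j.+1] across [up n] lowers its index by one, and moving it
    across [down n] restores it. *)
Lemma turn0_comm j : (j.+1 < n)%N -> commute (turn 0) (s j.+1).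
Proof.
move=> jn; rewrite /commute /= -mulgA down_shift // mulgA -up_shift //.
by rewrite -mulgA.
Qed.

Lemma turn_comm i j : (i <= n)%N -> (j < n)%N -> j != i -> j.+1 != i ->
  commute (turn i) (s j).
Proof.
have lt : forall i j, (i < j)%N -> (j < n)%N -> commute (turn i) (s j).
  elim=> [|k IHk] [|l] kl ln //; first exact: turn0_comm.
  rewrite -(commute_conj (x := s l.+1) (y := s k)) /=; last first.
    by apply/commute_sym/sig_far; lia.
  by apply/commuteJ/IHk; lia.
move=> ih jh ne1 ne2; have [/lt|ij] := ltnP i j; first exact.
have {ij} ij : (j.+2 <= i)%N by lia.
rewrite -(subnK ij) in ih *; elim: (i - j.+2)%N ih => [|d IHd] ih.
  rewrite add0n /= -conjgM.
  have {2}<- : s j.+1 ^ (s j * s j.+1) = s j.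
    by apply: braid_conj; rewrite sig_near //; lia.
  by apply/commuteJ/lt; lia.
rewrite addSn /= -(commute_conj (x := s j) (y := s (d + j.+2))); last first.
  by apply: sig_far; lia.
by apply/commuteJ/IHd; lia.
Qed.

(** For [j = 0]: the first turn is [s 0 * w * s 0], where [w] is a product of the
    other generators, with which the first turn commutes; this is the situation
    of [pair_comm].  Conjugation by [s j.+1 * s j] moves the statement from [j]
    to [j.+1]. *)
Lemma turn_pair j : (j < n)%N -> commute (turn j * turn j.+1) (s j).
Proof.
elim: j => [|j IHj] jn; last first.
  have c : commute (turn j) (s j.+1) by apply: turn_comm; lia.
  have e1 : turn j ^ (s j.+1 * s j) = turn j.+1.
    by rewrite conjgM (commute_conj c).
  have e2 : turn j.+1 ^ (s j.+1 * s j) = turn j.+2.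
    rewrite conjgM -[turn j.+1 ^ _]/(turn j.+2).
    by apply/commute_conj/turn_comm; lia.
  have e3 : s j ^ (s j.+1 * s j) = s j.+1 by apply: braid_conj; exact: sig_near.
  have := commuteJ (s j.+1 * s j) (IHj (ltnW jn)).
  by rewrite conjMg e1 e2 e3.
have [U [D [cU cD eUD]]] : exists U D, [/\ commute (turn 0) U,
    commute (turn 0) D & turn 0 = s 0 * U * (D * s 0)].
  have h k : (k < n)%N -> exists U, commute (turn 0) U /\ up k.+1 = s 0 * U.
    elim: k => [|k IHk] kn /=.
      by exists 1; rewrite mul1g mulg1; split; [exact: commute1|].
    have [|U [cU eU]] := IHk; first lia.
    exists (U * s k.+1); split; first by apply: commuteM => //; exact: turn0_comm.
    by rewrite mulgA -eU.
  have h' k : (k < n)%N -> exists U, commute (turn 0) U /\ down k.+1 = U * s 0.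
    elim: k => [|k IHk] kn /=.
      by exists 1; rewrite mul1g mulg1; split; [exact: commute1|].
    have [|U [cU eU]] := IHk; first lia.
    exists (s k.+1 * U); split; first by apply: commuteM => //; exact: turn0_comm.
    by rewrite -mulgA -eU.
  have [|U [cU eU]] := h n.-1; first lia.
  have [|D [cD eD]] := h' n.-1; first lia.
  by exists U, D; split=> //; rewrite -eU -eD prednK.
have c : commute (turn 0) (U * D) by apply: commuteM.
have et : turn 0 = s 0 * (U * D) * s 0 by rewrite eUD !mulgA.
exact: pair_comm et c.
Qed.

End Sigma.

(** * Adding a strand: a decomposition of the braid group *)

Section Turns.
Variable n : nat.
Local Notation s := (sig n).
Local Notation z := (xi n.+1).
Implicit Type b : braid_group n.+1.

Lemma artin_up_0 k : (k <= n)%N -> X 0 |> up n k = X k.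
Proof.
elim: k => [|k IHk] kn /=; first by rewrite artin_act1.
by rewrite artin_actM IHk ?artin_sig ?artin_l //; lia.
Qed.

Lemma artin_up_fix k j : (k < j)%N -> (k <= n)%N -> X j |> up n k = X j.
Proof.
elim: k => [|k IHk] kj kn /=; first by rewrite artin_act1.
by rewrite artin_actM IHk ?artin_sig ?artin_o //; lia.
Qed.

Lemma artin_upS k j : (j < k)%N -> (k <= n)%N -> X j.+1 |> up n k = X j ^ X k.
Proof.
elim: k => [//|k IHk] jk kn /=; rewrite artin_actM.
have [jk'|kj] := ltnP j k.
  by rewrite IHk ?artin_sig ?artin_letterJ ?(@artin_o k _ j) ?artin_l //; lia.
have -> : j = k by lia.
by rewrite artin_up_fix ?artin_sig ?artin_r //; lia.
Qed.

Lemma artin_down_fix k j : (k < j)%N -> (k <= n)%N -> X j |> down n k = X j.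
Proof.
elim: k => [|k IHk] kj kn /=; first by rewrite artin_act1.
by rewrite artin_actM artin_sig ?artin_o ?IHk //; lia.
Qed.

Lemma artin_down k j : (j < k)%N -> (k <= n)%N -> X j |> down n k = X j.+1.
Proof.
elim: k => [//|k IHk] jk kn /=; rewrite artin_actM artin_sig //.
have [jk'|kj] := ltnP j k; first by rewrite artin_o ?IHk //; lia.
have -> : j = k by lia.
by rewrite artin_l artin_down_fix //; lia.
Qed.

Lemma artin_down_top k : (k <= n)%N -> X k |> down n k = X 0 ^ xi k.+1.
Proof.
elim: k => [|k IHk] kn.
  by rewrite /= artin_act1 mul1g conjgE mulKg.
rewrite [xi k.+2]/= conjgM -/(xi k.+1) /= artin_actM artin_sig // artin_r artinJ.
by rewrite IHk ?artin_down_fix //; lia.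
Qed.

(** The action of [turn n i]: the strand [i] is conjugated by the loop around
    all strands, and every other strand by the loop around the strand [i],
    taken before or after that conjugation. *)
Lemma artin_turn i j : (i <= n)%N -> (j <= n)%N ->
  X j |> turn n i = if (j < i)%N then X j ^ X i
                    else if j == i then X i ^ z else X j ^ (X i ^ z).
Proof.
elim: i j => [|i IHi] j ni nj.
  rewrite ltn0 /= artin_actM; case: j nj => [|j] nj /=.
    by rewrite artin_up_0 // artin_down_top.
  by rewrite artin_upS // artinJ artin_down // artin_down_top.
rewrite [turn n _]/= conjgE !artin_actM artin_sigV //.
have zs : z |> s i = z by rewrite artin_xi.
have [->|ji] := eqVneq j i.
  rewrite artin_lV artinJ artinV !IHi ?ltnn ?eqxx //; try lia.
  rewrite gtn_eqF // ltnNge leqnSn /= conjgK artin_sig // artin_r.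
  by rewrite leqnn.
have [->|ji1] := eqVneq j i.+1.
  rewrite artin_rV IHi ?ltnn ?eqxx //; try lia.
  by rewrite artinJ zs artin_sig // artin_l.
rewrite artin_o // IHi //; try lia; rewrite (negPf ji).
have [lt|ge] := ltnP j i.
  have -> : (j < i.+1)%N by lia.
  by rewrite artinJ !artin_sig // artin_l artin_o.
have /negPf -> : ~~ (j < i.+1)%N by lia.
by rewrite !artinJ zs !artin_sig // artin_l artin_o.
Qed.

End Turns.

Section Push.
(* A last strand, of index [k.+1], is added to the strands [0, ..., k]. *)
Variable k : nat.
Local Notation B := (braid_group k.+1).
Local Notation BS := (braid_group k.+2).
Local Notation s := (sig k.+1).
Local Notation Fn := (free_group 'I_k.+1).

Lemma iota_rel u v : @braid_rel k.+1 u v ->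
  word_eval (fun i : 'I_k => s i) u = word_eval (fun i : 'I_k => s i) v.
Proof.
case=> {u v} i j ij /=; rewrite !mulg1.
  by apply: sig_far => //; exact: leqW (ltn_ord j).
by rewrite !mulgA ij sig_near // -ij; exact: leqW (ltn_ord j).
Qed.

Definition iota_braid : B -> BS := pres_lift iota_rel.

HB.instance Definition _ := Multiplicative.on iota_braid.

Local Notation iota := iota_braid.

Lemma iota_sig i : (i < k)%N -> iota (sig k i) = s i.
Proof. by move=> h; rewrite (sigE h) /iota_braid pres_lift_gen. Qed.

Lemma artin_iota x (b : B) : x |> iota b = x |> b.
Proof.
elim/sig_ind: b => [|i b h IHb|i b h IHb].
- by rewrite mmorph1 !artin_act1.
- by rewrite gmulfM /= iota_sig // !artin_actM IHb !artin_sig //; lia.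
- by rewrite gmulfM mmorphV /= iota_sig // !artin_actM IHb !artin_sigV //; lia.
Qed.

(** The free group of rank [k.+1] is the fundamental group of the sphere with
    the [k.+2] strands removed, based at infinity; [push w] drags the base
    point along the loop [w]. *)
Definition push : Fn -> BS := flift (fun i : 'I_k.+1 => turn k.+1 i).

HB.instance Definition _ := Multiplicative.on push.

Lemma push_gen (i : 'I_k.+1) : push (fgen i) = turn k.+1 i.
Proof. exact: flift_gen. Qed.

Lemma push_turn i : (i < k.+1)%N -> exists w, push w = turn k.+1 i.
Proof. by move=> h; exists (fgen (Ordinal h)); rewrite push_gen. Qed.

Definition normalises_push (g : BS) := forall w, exists w', push w ^ g = push w'.

Lemma normalises_push_gen (g : BS) :
  (forall i : 'I_k.+1, exists w', turn k.+1 i ^ g = push w') -> normalises_push g.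
Proof.
move=> h; elim/fgen_ind=> [|i w [w' e]|i w [w' e]].
- by exists 1; rewrite !mmorph1 conj1g.
- have [v ev] := h i; exists (v * w').
  by rewrite [push (_ * w)]gmulfM conjMg e /= push_gen ev gmulfM.
- have [v ev] := h i; exists (v^-1 * w').
  by rewrite [push (_ * w)]gmulfM conjMg e mmorphV conjVg /= push_gen ev gmulfM mmorphV.
Qed.

Lemma turn_pairJ j : (j < k.+1)%N ->
  turn k.+1 j.+1 ^ s j = turn k.+1 j ^ turn k.+1 j.+1.
Proof.
move=> h; have := commute_conj (turn_pair h).
rewrite conjMg -[turn k.+1 j ^ s j]/(turn k.+1 j.+1) => e.
by apply: (mulgI (turn k.+1 j.+1)); rewrite e conjgE mulVKg.
Qed.

Lemma normalises_push_sig j : (j < k)%N -> normalises_push (s j).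
Proof.
move=> jk; apply: normalises_push_gen => i; have ik := ltn_ord i.
have [w1 e1] := push_turn (ltnW jk : (j < k.+1)%N).
have [w2 e2] := @push_turn j.+1 jk.
have [->|ji] := eqVneq (i : nat) j; first by exists w2; rewrite e2.
have [->|ji1] := eqVneq (i : nat) j.+1.
  by exists (w1 ^ w2); rewrite mmorphJ /= e1 e2 turn_pairJ //; lia.
exists (fgen i); rewrite push_gen; apply/commute_conj/turn_comm; lia.
Qed.

Lemma normalises_push_sigV j : (j < k)%N -> normalises_push (s j)^-1.
Proof.
move=> jk; apply: normalises_push_gen => i; have ik := ltn_ord i.
have [w1 e1] := push_turn (ltnW jk : (j < k.+1)%N).
have [w2 e2] := @push_turn j.+1 jk.
have [->|ji] := eqVneq (i : nat) j.
  exists (w2 ^ w1^-1); rewrite mmorphJ mmorphV /= e1 e2.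
  apply: (conjg_inj (s j)); rewrite conjgKV /= conjJg conjVg.
  by rewrite turn_pairJ ?conjgK //; lia.
have [->|ji1] := eqVneq (i : nat) j.+1.
  by exists w1; rewrite e1 /= conjgK.
exists (fgen i); rewrite push_gen; apply/commute_conj/commuteV/turn_comm; lia.
Qed.

Lemma normalises_push_iota (b : B) : normalises_push (iota b).
Proof.
elim/sig_ind: b => [|i b h IHb|i b h IHb] w.
- by exists w; rewrite mmorph1 conjg1.
- have [w1 e1] := IHb w; have [w2 e2] := normalises_push_sig h w1.
  by exists w2; rewrite gmulfM /= iota_sig // conjgM e1 e2.
- have [w1 e1] := IHb w; have [w2 e2] := normalises_push_sigV h w1.
  by exists w2; rewrite gmulfM mmorphV /= iota_sig // conjgM e1 e2.
Qed.

Definition push_iota (x : BS) := exists w b, x = push w * iota b.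

Lemma push_iota_push w : push_iota (push w).
Proof. by exists w, 1; rewrite mmorph1 mulg1. Qed.

Lemma push_iota_iota b : push_iota (iota b).
Proof. by exists 1, b; rewrite mmorph1 mul1g. Qed.

Lemma push_iotaM x y : push_iota x -> push_iota y -> push_iota (x * y).
Proof.
move=> [w [b ->]] [v [c ->]].
have [v' e] := normalises_push_iota b^-1 v.
exists (w * v'), (b * c); rewrite !gmulfM /= -e mmorphV /= conjgE invgK !mulgA.
by rewrite mulgVK.
Qed.

Lemma push_iotaV x : push_iota x -> push_iota x^-1.
Proof.
move=> [w [b ->]]; have [v e] := normalises_push_iota b w^-1.
by exists v, b^-1; rewrite -e invgM !mmorphV /= conjgE !mulgA mulgK.
Qed.

Lemma push_iotaJ x y : push_iota x -> push_iota y -> push_iota (x ^ y).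
Proof.
by move=> hx hy; rewrite conjgE; apply/push_iotaM/push_iotaM => //; exact: push_iotaV.
Qed.

Lemma push_iota_sig j : (j < k)%N -> push_iota (s j).
Proof. by move=> h; rewrite -iota_sig //; exact: push_iota_iota. Qed.

Lemma push_iota_up j : (j <= k)%N -> push_iota (up k.+1 j).
Proof.
elim: j => [|j IHj] h /=; first by rewrite -(mmorph1 iota); exact: push_iota_iota.
by apply: push_iotaM (push_iota_sig _) => //; apply: IHj; lia.
Qed.

Lemma push_iota_down j : (j <= k)%N -> push_iota (down k.+1 j).
Proof.
elim: j => [|j IHj] h /=; first by rewrite -(mmorph1 iota); exact: push_iota_iota.
by apply: push_iotaM (push_iota_sig _) _ => //; apply: IHj; lia.
Qed.

(** A braid carrying the last strand to the position [k.+1 - d]. *)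
Fixpoint carry d := if d is e.+1 then carry e * s (k - e) else 1.

Lemma carry_far d j : (d <= k.+1)%N -> (j + d < k)%N -> commute (carry d) (s j).
Proof.
elim: d => [|d IHd] dk jd /=; first exact/commute_sym/commute1.
apply: commuteMl; first by apply: IHd; lia.
by apply/commute_sym/sig_far; lia.
Qed.

Lemma carry_near d j : (d <= k.+1)%N -> (k.+1 < j + d)%N -> (j <= k)%N ->
  carry d * s j = s j.-1 * carry d.
Proof.
elim: d => [|d IHd] dk jd jk /=; first lia.
have [lt|ge] := ltnP k.+1 (j + d).
  rewrite -mulgA (sig_far (i := k - d)) ?mulgA ?IHd //; lia.
case: d => [|d] in IHd dk jd ge *; first lia.
have ej : j = (k - d)%N by lia.
have -> : (k - d.+1)%N = j.-1 by lia.
rewrite /= -ej -!mulgA; have := @sig_near k.+1 j.-1.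
rewrite prednK; last lia.
move=> e; rewrite (mulgA (s j)) -e; last lia.
rewrite !mulgA (carry_far (j := j.-1)) //; lia.
Qed.

(** The full twists of two strands that multiplication by a generator produces
    belong to [push_iota]: for the last two strands this is [turn k.+1 k] up to
    braids of the first strands, and the others are conjugates of it. *)
Lemma push_iota_carry d : (d <= k)%N ->
  push_iota ((s (k - d) * s (k - d)) ^ (carry d)^-1).
Proof.
elim: d => [|d IHd] dk.
  rewrite subn0 /= invg1 conjg1.
  have -> : s k * s k = turn k.+1 k * (down k.+1 k * up k.+1 k)^-1.
    have tk i : (i <= k.+1)%N -> turn k.+1 i = turn k.+1 0 ^ up k.+1 i.
      elim: i => [|i IHi] ik; first by rewrite conjg1.
      by rewrite /= conjgM -IHi //; lia.
    rewrite tk // conjgE /= invgM !mulgA mulVg mul1g.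
    by rewrite !mulgK.
  apply: push_iotaM.
    by have [w <-] := push_turn (ltnSn k); exact: push_iota_push.
  apply/push_iotaV/push_iotaM; [exact: push_iota_down|exact: push_iota_up].
set j := (k - d.+1)%N; have ej : (k - d)%N = j.+1 by rewrite /j; lia.
rewrite ej in IHd; rewrite /= ej invgM conjgM.
have jk : (j.+1 < k.+1)%N by rewrite /j; lia.
have e : s j ^ (s j.+1)^-1 = s j.+1 ^ s j.
  apply: (conjg_inj (s j.+1)); rewrite conjgKV -conjgM.
  by rewrite braid_conj // sig_near.
rewrite conjMg e -conjMg.
have c : commute (s j) (carry d)^-1.
  by apply/commuteV/commute_sym/carry_far; rewrite /j; lia.
rewrite -conjgM c conjgM; apply: push_iotaJ; first by apply: IHd; lia.
by apply: push_iota_sig; rewrite /j; lia.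
Qed.

(** The cosets of the subgroup [push_iota] are represented by the braids
    [carry d], since multiplication by generators permutes these cosets. *)
Lemma braid_decomposition (x : BS) :
  exists y d, [/\ push_iota y, (d <= k.+1)%N & x = y * carry d].
Proof.
elim/sig_ind: x => [|j x jk [y [d [hy dk ->]]]|j x jk [y [d [hy dk ->]]]].
- exists 1, 0%N; split=> //; last by rewrite mulg1.
  by rewrite -(mmorph1 push); exact: push_iota_push.
- have [jd|jd] := ltnP (j + d) k.
    exists (y * s j), d; split=> //; last by rewrite -!mulgA carry_far.
    by apply: push_iotaM hy (push_iota_sig _); lia.
  have [jd'|jd'] := ltnP k.+1 (j + d).
    exists (y * s j.-1), d; split=> //; last by rewrite -!mulgA carry_near.
    by apply: push_iotaM hy (push_iota_sig _); lia.
  have [e|e] := eqVneq (j + d)%N k.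
    exists y, d.+1; split=> //; [lia|]; rewrite /= -mulgA.
    by congr (_ * (_ * s _)); lia.
  case: d dk jd jd' e => [|d] dk jd jd' e; first lia.
  have ej : j = (k - d)%N by lia.
  exists (y * (s j * s j) ^ (carry d)^-1), d; split; last 1 first.
  + by rewrite /= -ej conjgE invgK -!mulgA mulVg mulg1.
  + by apply: push_iotaM => //; rewrite ej; apply: push_iota_carry; lia.
  + lia.
- have [jd|jd] := ltnP (j + d) k.
    exists (y * (s j)^-1), d; split=> //; last first.
      by rewrite -!mulgA; congr (_ * _); apply/commuteV/carry_far.
    by apply: push_iotaM hy (push_iotaV (push_iota_sig _)); lia.
  have [jd'|jd'] := ltnP k.+1 (j + d).
    exists (y * (s j.-1)^-1), d; split=> //; last first.
      apply: (mulIg (s j)); rewrite mulgVK -!mulgA carry_near ?mulKg //.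
    by apply: push_iotaM hy (push_iotaV (push_iota_sig _)); lia.
  have [e|e] := eqVneq (j + d)%N k.
    have ej : j = (k - d)%N by lia.
    exists (y * ((s j * s j) ^ (carry d)^-1)^-1), d.+1; split; last 1 first.
    + by rewrite /= -ej conjgE invgK !invgM !invgK -!mulgA mulKg mulVg mulg1.
    + by apply/push_iotaM/push_iotaV => //; rewrite ej; apply: push_iota_carry; lia.
    + lia.
  case: d dk jd jd' e => [|d] dk jd jd' e; first lia.
  have ej : j = (k - d)%N by lia.
  exists y, d; split=> //; first lia.
  by rewrite /= -ej mulgA mulgK.
Qed.

End Push.

(** * Dihedral images, permutations and the action on the punctured sphere *)

Lemma zpowM (G : groupType) (x y : G) k : commute x y ->
  zpow (x * y) k = zpow x k * zpow y k.
Proof.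
case: k => n c /=; first by rewrite expgMn.
rewrite c expgMn ?invgM //; exact: commute_sym.
Qed.

Section Dihedral.
(** The infinite dihedral group: [(v, s)] is the map sending [x] to
    [v + (-1) ^ s x] on the integers. *)
Definition dih : Type := (int * bool)%type.

HB.instance Definition _ := Choice.on dih.

Definition dih_mul (a b : dih) : dih := ((a.1 + (-1) ^+ a.2 * b.1)%R, a.2 (+) b.2).
Definition dih_inv (a : dih) : dih := ((- ((-1) ^+ a.2 * a.1))%R, a.2).

Lemma dih_mulA : associative dih_mul.
Proof.
by move=> [a s] [b t] [c u]; rewrite /dih_mul /= addbA signr_addb mulrDr addrA mulrA.
Qed.
Lemma dih_mul1 : left_id (0%R, false) dih_mul.
Proof. by move=> [a s]; rewrite /dih_mul /= add0r mul1r. Qed.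
Lemma dih_mulr1 : right_id (0%R, false) dih_mul.
Proof. by move=> [a s]; rewrite /dih_mul /= mulr0 addr0 addbF. Qed.
Lemma dih_mulV : left_inverse (0%R, false) dih_inv dih_mul.
Proof. by move=> [a s]; rewrite /dih_mul /= addbb addNr. Qed.
Lemma dih_mulrV : right_inverse (0%R, false) dih_inv dih_mul.
Proof.
by move=> [a s]; rewrite /dih_mul /= addbb mulrN mulrA -signr_addb addbb mul1r subrr.
Qed.

HB.instance Definition _ := isGroup.Build dih
  dih_mulA dih_mul1 dih_mulr1 dih_mulV dih_mulrV.

Lemma dihM1 (a b : dih) : (a * b).1 = (a.1 + (-1) ^+ a.2 * b.1)%R.
Proof. by []. Qed.
Lemma dihM2 (a b : dih) : (a * b).2 = a.2 (+) b.2.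
Proof. by []. Qed.
Lemma dihV1 (a : dih) : a^-1.1 = (- ((-1) ^+ a.2 * a.1))%R.
Proof. by []. Qed.
Lemma dihV2 (a : dih) : a^-1.2 = a.2.
Proof. by []. Qed.

End Dihedral.

(** Exponent sums are computed in the group of translations. *)
Section Exponent.
Variables (m : nat).

Definition expo_dih : F -> dih := flift (fun j => (Posz (j == m), false) : dih).

HB.instance Definition _ := Multiplicative.on expo_dih.

Definition expo (x : F) : int := (expo_dih x).1.

Lemma expo_dih2 x : (expo_dih x).2 = false.
Proof.
elim/fgen_ind: x => [|i x IHx|i x IHx]; first by rewrite mmorph1.
  by rewrite gmulfM dihM2 IHx /= /expo_dih flift_gen.
by rewrite gmulfM dihM2 IHx mmorphV /= /expo_dih flift_gen.
Qed.

Lemma expoM x y : expo (x * y) = (expo x + expo y)%R.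
Proof. by rewrite /expo gmulfM dihM1 expo_dih2 mul1r. Qed.

Lemma expo1 : expo 1 = 0%R.
Proof. by rewrite /expo mmorph1. Qed.

Lemma expoV x : expo x^-1 = (- expo x)%R.
Proof. by rewrite /expo mmorphV dihV1 expo_dih2 mul1r. Qed.

Lemma expoJ x y : expo (x ^ y) = expo x.
Proof. by rewrite conjgE !expoM expoV addrCA addNr addr0. Qed.

Lemma expo_gen j : expo (X j) = Posz (j == m).
Proof. by rewrite /expo /expo_dih flift_gen. Qed.

Lemma expo_zpow x k : expo (zpow x k) = (expo x * k)%R.
Proof.
have pos n : expo (x ^+ n) = (expo x * n)%R.
  elim: n => [|n IHn]; first by rewrite expo1 mulr0.
  by rewrite expgS expoM IHn -{1}(mulr1 (expo x)) -mulrDr -intS.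
by case: k => n /=; rewrite ?expoV pos // NegzE mulrN.
Qed.

End Exponent.

Lemma expo_xi m n : (m < n)%N -> expo m (xi n) = 1%R.
Proof.
have low k : (k <= m)%N -> expo m (xi k) = 0%R.
  elim: k => [|k IHk] km /=; first exact: expo1.
  by rewrite expoM expo_gen IHk ?ltn_eqF //; lia.
elim: n => [//|n IHn] mn /=; rewrite expoM expo_gen.
have [->|ne] := eqVneq n m; first by rewrite low ?eqxx.
by rewrite IHn ?addr0 //; lia.
Qed.

Lemma gen_conj_inj i j (g h : F) : X i ^ g = X j ^ h -> i = j.
Proof.
move=> /(congr1 (expo j)); rewrite !expoJ !expo_gen eqxx.
by case: eqP.
Qed.

Section Permutation.
Variable n : nat.
Local Notation p := (@braid_perm n.+1).

Lemma braid_perm_sig i (h : (i < n)%N) :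
  p (sig n i) = @strand_swap n.+1 (Ordinal h).
Proof. by rewrite (sigE h) /braid_perm pres_lift_gen. Qed.

(** The image of a generator is a conjugate of the generator to which the
    underlying permutation sends it.  As exponent sums tell the conjugates of
    different generators apart, the action determines the permutation. *)
Lemma artin_perm (b : braid_group n.+1) (i : 'I_n.+1) :
  exists g, X i |> b = X (p b i) ^ g.
Proof.
have letter_conj k c (h : (k < n)%N) (j : 'I_n.+1) : exists g,
    artin_letter k c (X j) = X (@strand_swap n.+1 (Ordinal h) j) ^ g.
  have [ej|nl] := eqVneq j (@lstrand n.+1 (Ordinal h)).
    rewrite ej tpermL /=; case: c; last by exists 1; rewrite artin_l conjg1.
    by exists (X k)^-1; rewrite artin_lV.
  have [ej|nr] := eqVneq j (@rstrand n.+1 (Ordinal h)).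
    rewrite ej tpermR /=; case: c; first by exists 1; rewrite artin_rV conjg1.
    by exists (X k.+1); rewrite artin_r.
  by exists 1; rewrite tpermD 1?eq_sym // artin_o // conjg1.
move: i; elim/sig_ind: b => [|k b h IHb|k b h IHb] i.
- by exists 1; rewrite artin_act1 mmorph1 perm1 conjg1.
- have [g e] := IHb i; have [g' e'] := letter_conj k false h (p b i).
  rewrite artin_actM e artinJ artin_sig // e' gmulfM permM /= (braid_perm_sig h).
  by eexists; rewrite -conjgM.
- have [g e] := IHb i; have [g' e'] := letter_conj k true h (p b i).
  rewrite artin_actM e artinJ artin_sigV // e' gmulfM mmorphV permM /= (braid_perm_sig h).
  have -> : (@strand_swap n.+1 (Ordinal h))^-1 = @strand_swap n.+1 (Ordinal h).
    exact: tpermV.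
  by eexists; rewrite -conjgM.
Qed.

Lemma artin_perm_eq (b : braid_group n.+1) (i j : 'I_n.+1) g :
  X i |> b = X j ^ g -> p b i = j.
Proof.
by have [h ->] := artin_perm b i; move=> /gen_conj_inj e; apply: val_inj.
Qed.

End Permutation.

Section Turns.
Variable n : nat.
Local Notation s := (sig n).
Local Notation z := (xi n.+1).

Fixpoint turns i := if i is j.+1 then turns j * turn n j else 1.

Lemma turns_comm i j : (i <= n.+1)%N -> (j.+1 < i)%N -> commute (turns i) (s j).
Proof.
move=> iin ji; rewrite -(subnK ji) in iin *; elim: (i - j.+2)%N iin => [|d IHd] iin.
  rewrite add0n /= -mulgA; apply: commuteMl; last by apply: turn_pair; lia.
  have low k : (k <= j)%N -> commute (turns k) (s j); last exact: low.
  elim: k => [|k IHk] kj /=; first exact/commute_sym/commute1.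
  by apply: commuteMl; [apply: IHk | apply: turn_comm]; lia.
rewrite addSn /=; apply: commuteMl; first by apply: IHd; lia.
by apply: turn_comm; lia.
Qed.

Lemma artin_turn_xi i m : (i <= n)%N -> (m <= i)%N ->
  xi m |> turn n i = xi m ^ X i.
Proof.
move=> iin; elim: m => [|m IHm] mi /=; first by rewrite artin1 conj1g.
by rewrite artinM IHm ?artin_turn ?mi ?conjMg //; lia.
Qed.

(** For [i = n] this is conjugation of the last generator by [z], and of the
    others by [xi n] and then by [z], as for the product of the full twists on
    all strands and on all strands but the last. *)
Lemma artin_turns i j : (i <= n.+1)%N -> (j <= n)%N ->
  X j |> turns i = if (j < i)%N then (X j ^ xi i) ^ z else X j ^ (xi i ^ z).
Proof.
have zt k : z |> turn n k = z by rewrite artin_xi.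
elim: i => [|i IHi] iin jn.
  by rewrite /= artin_act1 conj1g conjg1.
rewrite [turns _]/= artin_actM IHi //; last lia.
have [lt|ge] := ltnP j i.
  rewrite ltnW // !artinJ zt artin_turn // lt artin_turn_xi // conjg_conj.
  by rewrite -(conjgM (X j)).
rewrite !artinJ zt artin_turn_xi // artin_turn // ltnNge ge /= ltnS.
have [->|ne] := eqVneq j i.
  rewrite leqnn conjg_conj /=; congr (_ ^ z).
  by rewrite conjgC conjgM [X i ^ X i]conjgE mulKg.
have /negPf -> : ~~ (j <= i)%N by lia.
by rewrite -conjgM -conjMg -conjgC.
Qed.

End Turns.

Section FreeFactor.
Variable k : nat.
Local Notation B := (braid_group k.+1).
Local Notation BS := (braid_group k.+2).
Local Notation Fn := (free_group 'I_k.+1).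
Local Notation iota := (@iota_braid k).
Local Notation push := (@push k).
Local Notation z := (xi k.+2).

Definition ffgen (j : nat) : Fn := if insub j is Some i then fgen (i : 'I_k.+1) else 1.

Lemma ffgen_ord (i : 'I_k.+1) : ffgen i = fgen i.
Proof. by rewrite /ffgen valK. Qed.

Fixpoint fxi_rec j : Fn := if j is i.+1 then fxi_rec i * ffgen i else 1.
Definition fxi := fxi_rec k.+1.

Definition incl : Fn -> F := flift (fun i : 'I_k.+1 => X i).
HB.instance Definition _ := Multiplicative.on incl.

(** Filling in the outer boundary: the product of the [k.+2] first generators
    becomes trivial, so that the last of them is expressed by the others. *)
Definition fill : F -> Fn := flift (fun j =>
  if (j < k.+1)%N then ffgen j else if j == k.+1 then fxi^-1 else 1).
HB.instance Definition _ := Multiplicative.on fill.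

Lemma incl_gen i : incl (fgen i) = X i. Proof. exact: flift_gen. Qed.

Lemma incl_ffgen j : (j < k.+1)%N -> incl (ffgen j) = X j.
Proof. by move=> h; rewrite -[j]/(val (Ordinal h)) ffgen_ord incl_gen. Qed.

Lemma fill_gen j : (j < k.+1)%N -> fill (X j) = ffgen j.
Proof. by rewrite /fill flift_gen => ->. Qed.

Lemma fill_last : fill (X k.+1) = fxi^-1.
Proof. by rewrite /fill flift_gen ltnn eqxx. Qed.

Lemma fill_high j : (k.+1 < j)%N -> fill (X j) = 1.
Proof. by move=> h; rewrite /fill flift_gen ltnNge ltnW // gtn_eqF. Qed.

Lemma fill_incl w : fill (incl w) = w.
Proof.
have := @free_morph_eq _ _ (fill \o incl) idfun; apply=> i /=.
by rewrite incl_gen fill_gen // ffgen_ord.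
Qed.

Lemma incl_fxi : incl fxi = xi k.+1.
Proof.
have h j : (j <= k.+1)%N -> incl (fxi_rec j) = xi j; last exact: h.
elim: j => [|j IHj] jk /=; first exact: mmorph1.
by rewrite gmulfM /= IHj ?incl_ffgen //; lia.
Qed.

Lemma fill_xi : fill (xi k.+1) = fxi.
Proof. by rewrite -incl_fxi fill_incl. Qed.

Lemma fill_z : fill z = 1.
Proof. by rewrite [z]/= -/(xi k.+1) gmulfM /= fill_last fill_xi mulgV. Qed.

Lemma push_fxi : push fxi = turns k.+1 k.+1.
Proof.
have h j : (j <= k.+1)%N -> push (fxi_rec j) = turns k.+1 j; last exact: h.
elim: j => [|j IHj] jk; first exact: mmorph1.
rewrite [fxi_rec _]/= gmulfM /= IHj; last lia.
by rewrite -[j]/(val (Ordinal jk)) ffgen_ord push_gen.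
Qed.

Lemma commute_push_fxi (b : B) : commute (push fxi) (iota b).
Proof.
rewrite push_fxi; elim/sig_ind: b => [|i b h IHb|i b h IHb].
- by rewrite mmorph1; exact: commute1.
- by rewrite gmulfM /= iota_sig //; apply: commuteM IHb _; apply: turns_comm.
- rewrite gmulfM mmorphV /= iota_sig //; apply: commuteM IHb _.
  by apply: commuteV; apply: turns_comm.
Qed.

Lemma fill_artin y (b : BS) : fill (incl (fill y) |> b) = fill (y |> b).
Proof.
have := @free_morph_eq _ _ (fill \o (artin_by b \o (incl \o fill))) (fill \o artin_by b).
apply=> j; rewrite /= /artin_by.
have [lt|] := ltnP j k.+1; first by rewrite fill_gen // incl_ffgen.
rewrite leq_eqVlt => /orP[/eqP <-|gt].
  rewrite fill_last !mmorphV /= incl_fxi artinV mmorphV /=.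
  apply: (mulgI (fill (xi k.+1 |> b))); rewrite mulgV -gmulfM -artinM.
  by rewrite -[_ * _]/z artin_xi //= fill_z.
by rewrite artin_high // fill_high // mmorph1 artin1 mmorph1.
Qed.

(** The action of braids on the fundamental group of the punctured sphere. *)
Definition alpha (b : BS) (w : Fn) : Fn := fill (incl w |> b).

Lemma alphaM b c w : alpha (b * c) w = alpha c (alpha b w).
Proof. by rewrite /alpha artin_actM fill_artin. Qed.

Lemma alpha1 w : alpha 1 w = w.
Proof. by rewrite /alpha artin_act1 fill_incl. Qed.

Lemma alpha_morph b : {morph alpha b : x y / x * y}.
Proof. by move=> x y; rewrite /alpha gmulfM artinM gmulfM. Qed.

HB.instance Definition _ b := isMultiplicative.Build Fn Fn (alpha b) (alpha_morph b).

(** Once [z] is trivial, conjugating by [X i] and by [X i ^ z] is the same, so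
    that a turn acts as an inner automorphism. *)
Lemma fill_turn y i (h : (i < k.+1)%N) : fill (y |> turn k.+1 i) = fill y ^ ffgen i.
Proof.
have cm : {morph (fun x => x ^ ffgen i) : x y / x * y} by move=> ? ?; rewrite conjMg.
pose M := isMultiplicative.Build Fn Fn _ cm.
pose cj : {multiplicative Fn -> Fn} := HB.pack (fun x => x ^ ffgen i) M.
have := @free_morph_eq _ _ (fill \o artin_by (turn k.+1 i)) (cj \o fill).
apply=> j; rewrite /= /artin_by; have [jk|jk] := leqP j k.+1.
  rewrite artin_turn //; last lia.
  have fJz x : fill (x ^ z) = fill x by rewrite mmorphJ /= fill_z conjg1.
  have e x : fill (X j ^ x) = fill (X j) ^ fill x by rewrite mmorphJ.
  case: ltnP => [_|_]; first by rewrite e (fill_gen h).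
  case: eqP => [->|_]; last by rewrite e fJz (fill_gen h).
  by rewrite fJz (fill_gen h) conjgE mulKg.
by rewrite artin_high // fill_high // conj1g.
Qed.

Lemma fill_push y w : fill (y |> push w) = fill y ^ w.
Proof.
elim/fgen_ind: w y => [|i w IHw|i w IHw] y.
- by rewrite mmorph1 artin_act1 conjg1.
- rewrite [push _]gmulfM /= push_gen artin_actM IHw fill_turn //.
  by rewrite ffgen_ord conjgM.
- rewrite [push _]gmulfM mmorphV /= push_gen artin_actM IHw conjgM; congr (_ ^ w).
  apply: (conjg_inj (fgen i)); rewrite conjgKV -ffgen_ord -fill_turn //.
  by rewrite artinVK.
Qed.

Lemma alpha_push w x : alpha (push w) x = x ^ w.
Proof. by rewrite /alpha fill_push fill_incl. Qed.

Lemma incl_fill_artin w (b : B) : incl (fill (incl w |> b)) = incl w |> b.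
Proof.
elim/sig_ind: b w => [|i b h IHb|i b h IHb] w.
- by rewrite !artin_act1 fill_incl.
- rewrite artin_actM -IHb artin_sig //; move: (fill (incl w |> b)) => u.
  have := @free_morph_eq _ _ (incl \o (fill \o (artin_letter i false \o incl)))
    (artin_letter i false \o incl); apply=> j /=.
  rewrite incl_gen; have jk := ltn_ord j.
  have [->|ji] := eqVneq (j : nat) i.
    by rewrite artin_l fill_gen ?incl_ffgen //; lia.
  have [->|ji1] := eqVneq (j : nat) i.+1.
    by rewrite artin_r !mmorphJ /= !fill_gen ?incl_ffgen //; lia.
  by rewrite artin_o ?fill_gen ?incl_ffgen //; lia.
- rewrite artin_actM -IHb artin_sigV //; move: (fill (incl w |> b)) => u.
  have := @free_morph_eq _ _ (incl \o (fill \o (artin_letter i true \o incl)))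
    (artin_letter i true \o incl); apply=> j /=.
  rewrite incl_gen; have jk := ltn_ord j.
  have [->|ji] := eqVneq (j : nat) i.
    by rewrite artin_lV !mmorphJ !mmorphV /= !fill_gen ?incl_ffgen //; lia.
  have [->|ji1] := eqVneq (j : nat) i.+1.
    by rewrite artin_rV fill_gen ?incl_ffgen //; lia.
  by rewrite artin_o ?fill_gen ?incl_ffgen //; lia.
Qed.

End FreeFactor.

(** * The theorems of Artin and Birman *)

Lemma conj_fix_commute (G : groupType) (x y : G) : x ^ y = x -> commute x y.
Proof. by move=> e; rewrite /commute conjgC e. Qed.

Lemma zpowVg (G : groupType) (x : G) m : zpow x^-1 m = zpow x (- m)%R.
Proof. by rewrite zpowN; case: m => n /=; rewrite expVgn. Qed.

(** [xi k.+1] can replace [X 0] in the basis, since [r] is a product of the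
    other generators. *)
Lemma xi_split k : exists r, xi k.+1 = X 0 * r /\
  forall f : {multiplicative F -> F}, (forall j, f (X j.+1) = X j.+1) -> f r = r.
Proof.
elim: k => [|k [r [e h]]].
  by exists 1; rewrite /= mul1g mulg1; split=> // f _; exact: mmorph1.
exists (r * X k.+1); split; first by rewrite mulgA -e.
by move=> f fX; rewrite gmulfM h // fX.
Qed.

(** The product [xi k.+1] is a member of a basis of the free group, so its
    centraliser is computed like that of a generator. *)
Lemma centraliser_xi k w : commute w (xi k.+1) -> exists m, w = zpow (xi k.+1) m.
Proof.
have [r [er fr]] := xi_split k.
pose f : {multiplicative F -> F} :=
  flift (fun j => if j is i.+1 then X j else X 0 * r).
pose g : {multiplicative F -> F} :=
  flift (fun j => if j is i.+1 then X j else X 0 * r^-1).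
have fX j : f (X j.+1) = X j.+1 by rewrite /f /= flift_gen.
have gX j : g (X j.+1) = X j.+1 by rewrite /g /= flift_gen.
have f0 : f (X 0) = X 0 * r by rewrite /f /= flift_gen.
have g0 : g (X 0) = X 0 * r^-1 by rewrite /g /= flift_gen.
have fg x : f (g x) = x.
  have := @free_morph_eq _ _ (f \o g) idfun; apply=> -[|j] /=.
    by rewrite g0 gmulfM mmorphV f0 fr // mulgK.
  by rewrite gX fX.
rewrite er => c; have := @gmulf_commute _ _ g _ _ c.
rewrite gmulfM g0 fr // mulgVK => /centraliser_fgen[m e].
by exists m; rewrite -(fg w) e zpow_morph f0.
Qed.

Section TurnPermutation.
Variable k : nat.

Lemma braid_perm_turn i : (i <= k)%N -> @braid_perm k.+1 (turn k i) = 1.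
Proof.
move=> ik; apply/permP => j; rewrite perm1.
have jk : (j <= k)%N by rewrite -ltnS.
have [g e] : exists g, X j |> turn k i = X j ^ g.
  rewrite artin_turn //; case: ifP => _; first by eexists.
  by case: eqP => [->|_]; eexists.
exact: artin_perm_eq e.
Qed.

End TurnPermutation.

Lemma braid_perm_push k (w : free_group 'I_k.+1) : @braid_perm k.+2 (push w) = 1.
Proof.
elim/fgen_ind: w => [|i w IHw|i w IHw].
- by rewrite !mmorph1.
- by rewrite !gmulfM /= IHw push_gen braid_perm_turn ?mulg1 //; apply: ltnW.
- by rewrite !gmulfM !mmorphV /= IHw push_gen braid_perm_turn ?invg1 ?mulg1 //; apply: ltnW.
Qed.

Lemma braid_perm_iota_last k (b : braid_group k.+1) :
  @braid_perm k.+2 (iota_braid b) ord_max = ord_max.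
Proof.
by apply: (@artin_perm_eq _ _ _ _ 1); rewrite conjg1 artin_iota artin_high.
Qed.

(** The representative [carry k d] of a coset sends the last strand to
    [k.+1 - d], whereas [push_iota] fixes it. *)
Lemma push_iota_of_perm k (x : braid_group k.+2) :
  @braid_perm k.+2 x ord_max = ord_max -> push_iota x.
Proof.
have [y [d [hy dk ->]]] := braid_decomposition x.
have -> : @braid_perm k.+2 (y * carry k d) ord_max = inord (k.+1 - d).
  have -> : @braid_perm k.+2 (y * carry k d) ord_max =
            @braid_perm k.+2 (carry k d) ord_max.
    rewrite gmulfM permM; congr (@braid_perm k.+2 (carry k d) _).
    case: hy => w [b ->]; rewrite gmulfM permM /= braid_perm_push perm1.
    exact: braid_perm_iota_last.
  have [g e] : exists g, X k.+1 |> carry k d = X (k.+1 - d) ^ g.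
    elim: d dk => [|d IHd] dk /=; first by exists 1; rewrite artin_act1 subn0 conjg1.
    have [|g e] := IHd _; first lia.
    rewrite artin_actM e artinJ artin_sig; last lia.
    have -> : (k.+1 - d = (k - d).+1)%N by lia.
    by rewrite artin_r subSS -conjgM; eexists.
  by apply: (@artin_perm_eq _ _ _ _ g); rewrite inordK ?e //; lia.
move=> /(congr1 val); rewrite /= inordK; last lia.
move=> ed; have -> : d = 0%N by lia.
by rewrite mulg1.
Qed.

(** The full twist on [k.+1] strands: the product of all turns but the last is
    the full twist times that on all strands but the last. *)
Fixpoint delta k : braid_group k.+1 :=
  if k is j.+1 then push (fxi j) * (iota_braid (delta j))^-1 else 1.

Lemma artin_delta k j : (j <= k)%N -> X j |> delta k = X j ^ xi k.+1.
Proof.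
elim: k j => [|k IHk] j jk.
  have -> : j = 0%N by lia.
  by rewrite artin_act1 /= mul1g conjgE mulKg.
rewrite [delta _]/= push_fxi artin_actM artin_turns //.
have e (y : F) : y |> (iota_braid (delta k))^-1 = y |> (delta k)^-1.
  by rewrite -mmorphV artin_iota.
have [lt|ge] := ltnP j k.+1; rewrite !e !artinJ !artin_xi //.
  have -> : X j |> (delta k)^-1 = X j ^ (xi k.+1)^-1.
    apply: (conjg_inj (xi k.+1)); rewrite conjgKV.
    by rewrite -[in RHS](artinK (X j) (delta k)) IHk // artinJ artin_xi.
  by rewrite conjgKV.
have -> : j = k.+1 by lia.
rewrite artin_high // [xi k.+2]/= -/(xi k.+1).
rewrite [xi k.+1 ^ _]conjgM [xi k.+1 ^ xi k.+1]conjgE mulKg.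
by rewrite conjgC conjgM [X k.+1 ^ X k.+1]conjgE mulKg.
Qed.

Lemma artin_zpow n x (b : braid_group n) m : zpow x m |> b = zpow (x |> b) m.
Proof. exact: (zpow_morph (artin_by b)). Qed.

Lemma artin_zpow_delta k j m : (j <= k)%N ->
  X j |> zpow (delta k) m = X j ^ zpow (xi k.+1) m.
Proof.
have S (y : F) l : y |> zpow (delta k) (1 + l)%R = (y |> delta k) |> zpow (delta k) l.
  by rewrite zpowS artin_actM.
have pos n : (j <= k)%N -> X j |> zpow (delta k) (Posz n) = X j ^ zpow (xi k.+1) n.
  move=> jk; elim: n => [|n IHn]; first by rewrite artin_act1 conjg1.
  have -> : Posz n.+1 = (1 + Posz n)%R by lia.
  by rewrite S artin_delta // artinJ IHn artin_xi // zpowS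
     (commute_zpow n (commute_refl (xi k.+1))) conjgM.
move=> jk; case: m => n; first exact: pos.
apply: (conjg_inj (zpow (xi k.+1) n.+1)); rewrite NegzE !zpowN conjgKV.
have -> : zpow (xi k.+1) n.+1 = zpow (xi k.+1) n.+1 |> (zpow (delta k) n.+1)^-1.
  by rewrite artin_zpow artin_xi.
by rewrite -artinJ -pos // artinK.
Qed.

Arguments xi : simpl never.

Definition artin_faithful k := forall b : braid_group k.+1,
  (forall j, (j <= k)%N -> X j |> b = X j) -> b = 1.

(** If a braid [push w * iota_braid b] acts trivially on the free group of the
    [k.+1] first strands, then evaluating on [xi] shows that [w] centralises
    [xi], hence is a power of it; faithfulness for one strand fewer then
    identifies [b]. *)
Lemma push_iota_alpha1 k : artin_faithful k ->
  forall w (b : braid_group k.+1), (forall y, alpha (push w * iota_braid b) y = y) ->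
  exists m, w = zpow (fxi k) m /\ b = zpow (delta k) (- m)%R.
Proof.
move=> faith w b ax.
have {}ax y : incl (y ^ w) |> b = incl y.
  by rewrite -[in RHS](ax y) alphaM alpha_push /alpha !artin_iota incl_fill_artin.
have [m em] : exists m, incl w = zpow (xi k.+1) m.
  apply: centraliser_xi; apply/commute_sym.
  have := ax (fxi k); rewrite mmorphJ /= incl_fxi => e.
  apply/conj_fix_commute/(can_inj (fun y => artinK y b)).
  by rewrite e artin_xi.
exists m; split; first by rewrite -(fill_incl w) em zpow_morph /= fill_xi.
rewrite zpowN; apply: (mulIg (zpow (delta k) m)); rewrite mulVg.
apply: faith => j jk; rewrite artin_actM.
have ej : incl (ffgen k j) = X j by rewrite incl_ffgen.
have := ax (ffgen k j); rewrite mmorphJ /= ej em artinJ artin_zpow artin_xi // => e.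
apply: (conjg_inj (zpow (xi k.+1) m)).
rewrite -[in RHS]artin_zpow_delta // -[in RHS]e artinJ; congr (_ ^ _).
by rewrite artin_zpow artin_xi.
Qed.

Lemma kernel_alpha_aux k : artin_faithful k -> forall x : braid_group k.+2,
  push_iota x -> (forall w, alpha x w = w) -> exists m, x = zpow (delta k.+1) m.
Proof.
move=> faith x [w [b ->]] /(push_iota_alpha1 faith)[m [ew eb]].
have e1 : push w = zpow (push (fxi k)) m by rewrite ew zpow_morph.
have e2 : iota_braid b = zpow (iota_braid (delta k))^-1 m.
  by rewrite zpowVg -zpow_morph -eb.
exists m; rewrite e1 e2 -zpowM //.
exact/commuteV/commute_push_fxi.
Qed.

Lemma braid_perm_fix k (x : braid_group k.+1) :
  (forall j, (j <= k)%N -> X j |> x = X j) -> @braid_perm k.+1 x = 1.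
Proof.
move=> fx; apply/permP => j; rewrite perm1.
by apply: (@artin_perm_eq _ _ _ _ 1); rewrite fx ?conjg1 // -ltnS.
Qed.

(** Artin's theorem, by induction on the number of strands: a braid that acts
    trivially has trivial permutation, hence lies in [push_iota]; it is then a
    power of the full twist by the induction hypothesis, and the full twist
    acts by conjugation by [xi], no power of which is central. *)
Theorem artin_faithfulP k : artin_faithful k.
Proof.
elim: k => [|k IHk] x fx; first by elim/sig_ind: x {fx} => // i x; rewrite ltn0.
have px := braid_perm_fix fx.
have [||m e] := kernel_alpha_aux IHk (x := x).
- by apply: push_iota_of_perm; rewrite px perm1.
- move=> w; have := @free_morph_eq _ _ (@alpha k x) idfun; apply=> j.
  rewrite /= /alpha incl_gen fx; last exact: ltnW.
  by rewrite fill_gen // ffgen_ord.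
have := fx 0%N isT; rewrite e artin_zpow_delta // => c.
have /centraliser_fgen[l el] : commute (zpow (xi k.+2) m) (X 0).
  exact/commute_sym/conj_fix_commute.
have := congr1 (expo 1) el; rewrite !expo_zpow expo_xi // expo_gen /= mul0r mul1r.
by move=> ->.
Qed.

Lemma artin_inj k (b c : braid_group k.+1) :
  (forall j, (j <= k)%N -> X j |> b = X j |> c) -> b = c.
Proof.
move=> h; apply/divg1_eq/artin_faithfulP => j jk.
by rewrite artin_actM h // artinK.
Qed.

(** Birman's theorem: on the fundamental group of the sphere punctured at the
    strands, only the powers of the full twist act trivially. *)
Theorem kernel_alpha k (x : braid_group k.+2) :
  @braid_perm k.+2 x = 1 -> (forall w, alpha x w = w) ->
  exists m, x = zpow (delta k.+1) m.
Proof.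
move=> px; apply: kernel_alpha_aux; first exact: artin_faithfulP.
by apply: push_iota_of_perm; rewrite px perm1.
Qed.

Lemma delta_central k (b : braid_group k.+1) : commute (delta k) b.
Proof.
have gen i : (i < k)%N -> commute (delta k) (sig k i).
  move=> ik; apply: artin_inj => j jk; rewrite !artin_actM artin_delta //.
  rewrite artinJ artin_xi // !artin_sig //.
  have [->|ji] := eqVneq j i; first by rewrite artin_l artin_delta.
  have [->|ji1] := eqVneq j i.+1.
    rewrite artin_r artinJ !artin_delta; try lia.
    exact: conjJg.
  by rewrite artin_o // artin_delta.
elim/sig_ind: b => [|i b h IHb|i b h IHb]; first exact: commute1.
  by apply: commuteM IHb _; apply: gen.
by apply: commuteM IHb _; apply/commuteV/gen.
Qed.

Lemma braid_perm_delta k : @braid_perm k.+1 (delta k) = 1.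
Proof.
apply/permP => j; rewrite perm1.
by apply: artin_perm_eq; apply: artin_delta; rewrite -ltnS.
Qed.

(** * The Burau representation at minus one on dihedral images *)

(** Each integer family [e] defines a homomorphism to the dihedral group sending
    [X i] to the reflection [x |-> e i - x]; [V e] is its value at the origin,
    and [sgn] the parity of the length, which does not depend on [e]. *)
Definition Vdih (e : nat -> int) : F -> dih := flift (fun i => (e i, true) : dih).

HB.instance Definition _ e := Multiplicative.on (Vdih e).

Definition V e x : int := (Vdih e x).1.
Definition sgn (x : F) : bool := (Vdih (fun=> 0%R) x).2.

Section Valuation.
Local Open Scope ring_scope.

Lemma Vdih2 e x : (Vdih e x).2 = sgn x.
Proof.
rewrite /sgn; elim/fgen_ind: x => [|i x IHx|i x IHx]; first by rewrite !mmorph1.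
  by rewrite !gmulfM !dihM2 IHx /= /Vdih !flift_gen.
by rewrite !gmulfM !dihM2 IHx !mmorphV !dihV2 /= /Vdih !flift_gen.
Qed.

Lemma VdihE e x : Vdih e x = (V e x, sgn x).
Proof. by rewrite -(Vdih2 e) /V; case: (Vdih e x). Qed.

Lemma V1 e : V e 1%g = 0.
Proof. by rewrite /V mmorph1. Qed.
Lemma sgn1 : sgn 1%g = false.
Proof. by rewrite /sgn mmorph1. Qed.
Lemma VM e x y : V e (x * y)%g = V e x + (-1) ^+ sgn x * V e y.
Proof. by rewrite /V gmulfM dihM1 Vdih2. Qed.
Lemma sgnM x y : sgn (x * y)%g = sgn x (+) sgn y.
Proof. by rewrite /sgn gmulfM dihM2. Qed.
Lemma VVg e x : V e x^-1%g = - ((-1) ^+ sgn x * V e x).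
Proof. by rewrite /V mmorphV dihV1 Vdih2. Qed.
Lemma sgnV x : sgn x^-1%g = sgn x.
Proof. by rewrite /sgn mmorphV dihV2. Qed.
Lemma V_gen e i : V e (X i) = e i.
Proof. by rewrite /V /Vdih flift_gen. Qed.
Lemma sgn_gen i : sgn (X i) = true.
Proof. by rewrite /sgn /Vdih flift_gen. Qed.
Lemma sgnJ x y : sgn (x ^ y)%g = sgn x.
Proof. by rewrite conjgE !sgnM sgnV; case: (sgn x); case: (sgn y). Qed.
Lemma VJ e x y : sgn x = true ->
  V e (x ^ y)%g = - ((-1) ^+ sgn y * V e y) *+ 2 + (-1) ^+ sgn y * V e x.
Proof.
move=> sx; rewrite conjgE !VM VVg sgnV sx; case: (sgn y); rewrite /= ?expr1 ?expr0; ring.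
Qed.

Lemma V_xi e n : V e (xi n) = \sum_(j < n) (-1) ^+ j * e j.
Proof.
have sx m : sgn (xi m) = odd m.
  by elim: m => [|m IHm]; rewrite ?sgn1 // [xi _]/(xi m * X m)%g sgnM sgn_gen IHm addbT.
elim: n => [|n IHn]; first by rewrite V1 big_ord0.
by rewrite [xi _]/(xi n * X n)%g VM V_gen IHn big_ord_recr /= sx signr_odd.
Qed.

Lemma sgn_xi n : sgn (xi n) = odd n.
Proof.
by elim: n => [|n IHn]; rewrite ?sgn1 // [xi _]/(xi n * X n)%g sgnM sgn_gen IHn addbT.
Qed.

Lemma V_genM e i x : V e (X i * x)%g = e i - V e x.
Proof. by rewrite VM V_gen sgn_gen expr1 mulN1r. Qed.

Lemma V_genVM e i x : V e ((X i)^-1 * x)%g = e i - V e x.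
Proof. by rewrite VM VVg sgnV V_gen sgn_gen expr1 !mulN1r opprK. Qed.

Lemma V_const x : V (fun=> 1) x = (sgn x)%:R.
Proof.
elim/fgen_ind: x => [|i x IHx|i x IHx]; first by rewrite V1 sgn1.
  by rewrite VM sgnM V_gen !sgn_gen IHx; case: (sgn x).
by rewrite VM VVg sgnM sgnV V_gen !sgn_gen IHx; case: (sgn x).
Qed.

Lemma V_comb e (n : nat) x : (forall j, (n <= j)%N -> e j = 0) ->
  V e x = \sum_(j < n) e j * V (fun i => (i == j)%:R) x.
Proof.
move=> e0; have ge i : e i = \sum_(j < n) e j * (i == j :> nat)%:R.
  have [lt|le] := ltnP i n.
    rewrite (bigD1 (Ordinal lt)) //= eqxx mulr1 big1 ?addr0 // => j.
    by rewrite -val_eqE /= eq_sym => /negPf ->; rewrite mulr0.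
  rewrite e0 // big1 // => j _; rewrite gtn_eqF ?mulr0 //.
  exact: leq_trans (ltn_ord j) le.
have comb i y : V e y = \sum_(j < n) e j * V (fun i => (i == j)%:R) y ->
    e i - V e y = \sum_(j < n) e j * ((i == j :> nat)%:R - V (fun i => (i == j)%:R) y).
  move=> ->; rewrite ge -sumrB; apply: eq_bigr => j _.
  by rewrite mulrBr.
elim/fgen_ind: x => [|i x IHx|i x IHx].
- by rewrite V1 big1 // => j _; rewrite V1 mulr0.
- by rewrite V_genM comb //; apply: eq_bigr => j _; rewrite V_genM.
- by rewrite V_genVM comb //; apply: eq_bigr => j _; rewrite V_genVM.
Qed.

End Valuation.

Section FamilyAction.
Variable k : nat.
Implicit Types (b : braid_group k.+1) (e : nat -> int).
Local Open Scope ring_scope.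

(** The left action of braids on integer families, dual to the right action on
    the free group through [V]. *)
Definition fam e b : nat -> int := fun i => V e (X i |> b).

Lemma sgn_artin_gen i b : sgn (X i |> b) = true.
Proof.
have [lt|le] := ltnP i k.+1; last by rewrite artin_high ?sgn_gen.
have [g /= ->] := artin_perm b (Ordinal lt).
by rewrite sgnJ sgn_gen.
Qed.

Lemma Vdih_artin e b x : Vdih e (x |> b) = Vdih (fam e b) x.
Proof.
have := @free_morph_eq _ _ (Vdih e \o artin_by b) (Vdih (fam e b)); apply=> i /=.
by rewrite /artin_by !VdihE V_gen sgn_gen sgn_artin_gen.
Qed.

Lemma V_artin e b x : V e (x |> b) = V (fam e b) x.
Proof. by rewrite /V Vdih_artin. Qed.

Lemma famM e b c i : fam e (b * c)%g i = fam (fam e c) b i.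
Proof. by rewrite /fam artin_actM V_artin. Qed.

Lemma fam1 e i : fam e 1%g i = e i.
Proof. by rewrite /fam artin_act1 V_gen. Qed.

Lemma fam_high e b i : (k < i)%N -> fam e b i = e i.
Proof. by move=> ki; rewrite /fam artin_high ?V_gen. Qed.

Lemma V_fam_xi e b : V (fam e b) (xi k.+1) = V e (xi k.+1).
Proof. by rewrite -V_artin artin_xi. Qed.

Lemma fam_sig e i j : (i < k)%N -> fam e (sig k i) j =
  if j == i then e i.+1 else if j == i.+1 then e i.+1 *+ 2 - e i else e j.
Proof.
move=> ik; rewrite /fam artin_sig //.
have [->|ji] := eqVneq j i; first by rewrite artin_l V_gen.
have [->|ji1] := eqVneq j i.+1; last by rewrite artin_o ?V_gen.
by rewrite artin_r VJ ?sgn_gen // !V_gen expr1; ring.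
Qed.

(** The alternating sign turns the action of the generators on consecutive
    differences into the Burau matrices at [t = -1]. *)
Definition diff_vec e : 'cV[int]_k := \col_j ((-1) ^+ j * (e j - e j.+1)).

Lemma diff_vec_sig e (i : 'I_k) :
  diff_vec (fam e (sig k i)) = burau_mx (- 1 : int) (n := k.+1) i *m diff_vec e.
Proof.
rewrite burau_mxE mulmxDl mul1mx /burau_pert -mulmxA -rowE.
rewrite [row _ _]mx11_scalar mul_mx_scalar.
apply/matrixP => j o; rewrite !mxE /= !fam_sig //.
rewrite -val_eqE /= eqSS.
have [ji1|ji1] := eqVneq j.+1 i.
  rewrite -ji1 ltn_eqF // exprS ltn_eqF ?(gtn_eqF (leqnn _)) //.
  by ring.
have [ji|ji] := eqVneq (j : nat) i.
  by rewrite ji; ring.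
have [ji2|ji2] := eqVneq (j : nat) i.+1.
  by rewrite ji2 exprS; ring.
by ring.
Qed.

Lemma diff_vec_fam e b : diff_vec (fam e b) = val (burau (unitrN1 int) k.+1 b) *m diff_vec e.
Proof.
have sigE i (h : (i < k)%N) : val (burau (unitrN1 int) k.+1 (sig k i)) =
    burau_mx (- 1 : int) (n := k.+1) (Ordinal h).
  by rewrite (sigE h) /burau pres_lift_gen.
elim/sig_ind: b e => [|i b h IHb|i b h IHb] e.
- have -> : fam e 1%g = e by apply/funext => i; rewrite fam1.
  by rewrite mmorph1 mul1mx.
- have -> : fam e (b * sig k i)%g = fam (fam e (sig k i)) b.
    by apply/funext => j; rewrite famM.
  by rewrite IHb (diff_vec_sig e (Ordinal h)) gmulfM /= sigE mulmxA.
- have -> : fam e (b * (sig k i)^-1)%g = fam (fam e (sig k i)^-1%g) b.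
    by apply/funext => j; rewrite famM.
  rewrite IHb gmulfM mmorphV /= sigE -mulmxA; congr (_ *m _).
  have {2}<- : fam (fam e (sig k i)^-1%g) (sig k i) = e.
    by apply/funext => j; rewrite -famM mulgV fam1.
  rewrite (diff_vec_sig _ (Ordinal h)) mulKmx //.
  exact: (@burau_mx_unit _ _ k.+1 (unitrN1 int) (Ordinal h)).
Qed.

Lemma diff_vec_surj (c : 'cV[int]_k) : exists e, diff_vec e = c.
Proof.
pose f i := if insub i is Some j then c (j : 'I_k) 0 else 0.
exists (fun i => - \sum_(j < i) (-1) ^+ j * f j).
apply/matrixP => j o; rewrite mxE (ord1 o) big_ord_recr /=.
rewrite opprK addKr mulrA -exprMn mulrNN mulr1 expr1n mul1r.
by rewrite /f valK.
Qed.

(** At [t = -1] the Burau matrix of [b] is the matrix of the action of [b] on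
    differences of consecutive members of families. *)
Lemma burau_kernelP b : reflect
  ((@braid_perm k.+1 b = 1)%g /\
   forall e j, (j < k)%N -> fam e b j - fam e b j.+1 = e j - e j.+1)
  (b \in burau_kernel k.+1).
Proof.
have -> : (b \in burau_kernel k.+1) =
    ((@braid_perm k.+1 b == 1) && (burau (unitrN1 int) k.+1 b == 1))%g by [].
apply: (iffP andP) => -[/eqP pb h].
  split=> // e j jk; have := diff_vec_fam e b.
  rewrite (eqP h) mul1mx => /matrixP/(_ (Ordinal jk) 0); rewrite !mxE /=.
  by apply: mulrI; exact: unitrX.
split; first by rewrite pb.
apply/eqP/val_inj/matrixP => i j /=.
have [e ee] := diff_vec_surj (delta_mx j 0).
have de : diff_vec (fam e b) = diff_vec e.
  by apply/matrixP => l o; rewrite !mxE h.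
have := diff_vec_fam e b; rewrite de ee -colE => /matrixP/(_ i 0).
by rewrite !mxE eqxx andbT => <-.
Qed.

End FamilyAction.

(** * Criteria for membership in the kernel *)

Section KernelCriteria.
Variable k : nat.
Implicit Types (b : braid_group k.+1) (e : nat -> int).
Local Open Scope ring_scope.

Lemma alternating_sum n : \sum_(j < n) (-1) ^+ j = (odd n)%:R :> int.
Proof.
elim: n => [|n IHn]; first by rewrite big_ord0.
by rewrite big_ord_recr /= IHn -signr_odd; case: (odd n).
Qed.

(** A braid in the kernel translates every family by a constant.  The alternating
    sum of a family is invariant, and for an odd number of terms translating by
    [c] adds [c] to it; so [c = 0]. *)
Lemma kernel_fam_odd b e : ~~ odd k -> b \in burau_kernel k.+1 -> fam e b =1 e.
Proof.
move=> ek /burau_kernelP[_ /(_ e) h] j.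
have [lt|] := ltnP k j; first exact: fam_high.
set c := fam e b 0 - e 0%N; have fc i : (i <= k)%N -> fam e b i = e i + c.
  elim: i => [|i IHi] ik; first by rewrite /c addrC subrK.
  by have := h i ik; rewrite IHi ?(ltnW ik) //; lia.
move=> jk; rewrite fc //; suff -> : c = 0 by rewrite addr0.
have := V_fam_xi e b; rewrite !V_xi.
rewrite (eq_bigr (fun j : 'I_k.+1 => (-1) ^+ j * e j + (-1) ^+ j * c)); last first.
  by move=> i _; rewrite fc -1?ltnS ?mulrDr.
rewrite big_split /= -mulr_suml alternating_sum /= ek mul1r.
by move=> /(canRL (addKr _)) ->; rewrite addNr.
Qed.

Lemma kernel_of_fam b : (@braid_perm k.+1 b = 1)%g ->
  (forall e j, (j <= k)%N -> fam e b j = e j) -> b \in burau_kernel k.+1.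
Proof.
move=> pb h; apply/burau_kernelP; split=> // e j jk.
by rewrite !h // ltnW.
Qed.

Lemma fam_delta e j : (j <= k)%N -> fam e (delta k) j =
  - ((-1) ^+ (~~ odd k) * V e (xi k.+1)) *+ 2 + (-1) ^+ (~~ odd k) * e j.
Proof. by move=> jk; rewrite /fam artin_delta // VJ ?sgn_gen // sgn_xi V_gen. Qed.

Lemma kernel_delta : odd k -> delta k \in burau_kernel k.+1.
Proof.
move=> ok; apply/burau_kernelP; split; first exact: braid_perm_delta.
by move=> e j jk; rewrite !fam_delta ?(ltnW jk) // ok !mul1r; ring.
Qed.

Lemma kernel_delta_sqr : ~~ odd k -> (delta k * delta k)%g \in burau_kernel k.+1.
Proof.
move=> ok; apply: kernel_of_fam.
  by rewrite gmulfM /= braid_perm_delta mulg1.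
move=> e j jk; rewrite famM !fam_delta // V_fam_xi ok expr1; ring.
Qed.

End KernelCriteria.

Section Completion.
Variable k : nat.
Local Notation B := (braid_group k.+1).
Local Notation BS := (braid_group k.+2).
Local Notation Fn := (free_group 'I_k.+1).
Local Notation z := (xi k.+2).
Implicit Types (b : B) (e : nat -> int) (w : Fn).
Local Open Scope ring_scope.

Lemma fam_iota e b : fam e (iota_braid b) =1 fam e b.
Proof. by move=> i; rewrite /fam artin_iota. Qed.

(** For an odd number of strands the kernel fixes all families, and then so does
    its image in the braid group with one more strand. *)
Lemma kernel_iota b : ~~ odd k -> b \in burau_kernel k.+1 ->
  iota_braid b \in burau_kernel k.+2.
Proof.
move=> ek kb; have /burau_kernelP[pb _] := kb.
apply: kernel_of_fam => [|e j jk]; last by rewrite fam_iota kernel_fam_odd.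
apply/permP => j; rewrite perm1.
have [lt|le] := ltnP j k.+1; last first.
  have -> : j = ord_max by apply/val_inj/eqP; rewrite eqn_leq le -ltnS ltn_ord.
  exact: braid_perm_iota_last.
have [g eg] := artin_perm b (Ordinal lt).
by apply: (@artin_perm_eq _ _ _ _ g); rewrite artin_iota eg pb perm1.
Qed.

Hypothesis even_k : ~~ odd k.

Lemma sgn_z : sgn z = false.
Proof. by rewrite sgn_xi /= negbK (negPf even_k). Qed.

Lemma fam_turn_z e i : (i <= k.+1)%N -> V e (X i ^ z)%g = e i - V e z *+ 2.
Proof. by move=> ik; rewrite VJ ?sgn_gen // sgn_z V_gen; ring. Qed.

Lemma fam_turn e i j : (i <= k.+1)%N -> (j <= k)%N ->
  fam e (turn k.+1 i) j - fam e (turn k.+1 i) j.+1 =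
  - (e j - e j.+1) + ((i == j)%:R + (i == j.+1)%:R) * V e z *+ 2.
Proof.
move=> ik jk; rewrite /fam !artin_turn //; last exact: leqW.
have c1 l : V e (X l ^ X i)%g = e i *+ 2 - e l.
  by rewrite VJ ?sgn_gen // !V_gen expr1; ring.
have c2 l : V e (X l ^ (X i ^ z))%g = (e i - V e z *+ 2) *+ 2 - e l.
  by rewrite VJ ?sgn_gen // sgnJ sgn_gen fam_turn_z // V_gen expr1; ring.
have [lt|ge] := ltnP j i.
  have -> : (i == j) = false by lia.
  have [lt1|ge1] := ltnP j.+1 i.
    have -> : (i == j.+1) = false by lia.
    by rewrite !c1 /=; ring.
  have -> : j.+1 = i by lia.
  by rewrite eqxx c1 fam_turn_z //=; ring.
have -> : (j.+1 < i)%N = false by lia.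
have -> : (i == j.+1) = false by lia.
have -> : (j.+1 == i) = false by lia.
have [->|ne] := eqVneq j i; first by rewrite fam_turn_z // c2 /=; ring.
by rewrite !c2 /=; ring.
Qed.

Lemma V_fam_z e (x : BS) : V (fam e x) z = V e z.
Proof. exact: V_fam_xi. Qed.

(** The braid [push w] acts on differences through a sign and a translation
    along the invariant value of [z], the latter being read off from the
    image of [w] in the dihedral groups. *)
Lemma fam_push e w j : (j <= k)%N ->
  fam e (push w) j - fam e (push w) j.+1 =
  (-1) ^+ sgn (incl w) * (e j - e j.+1) +
  V (fun i => (i == j)%:R + (i == j.+1)%:R) (incl w) * V e z *+ 2.
Proof.
move=> jk; elim/fgen_ind: w => [|i w IHw|i w IHw].
- by rewrite !mmorph1 !fam1 sgn1 V1; ring.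
- rewrite !gmulfM /= push_gen incl_gen !famM fam_turn; last 2 first.
    exact: ltnW. exact: jk.
  rewrite V_fam_z IHw sgnM sgn_gen V_genM addTb signrN.
  move: (V e z) (V _ (incl w)) (_ ^+ sgn _) => a b c; ring.
- rewrite !gmulfM !mmorphV /= push_gen incl_gen sgnM sgnV sgn_gen V_genVM addTb signrN.
  rewrite !famM; set f := fam e (push w) in IHw *.
  set h := fam f (turn k.+1 i)^-1%g.
  have fh l : fam h (turn k.+1 i) l = f l by rewrite -famM mulgV fam1.
  have := @fam_turn h i j (ltnW (ltn_ord i)) jk.
  rewrite !fh IHw V_fam_z V_fam_z => e1.
  have e2 (x y c : int) : x = - y + c -> y = c - x by move=> ->; ring.
  rewrite (e2 _ _ _ e1); move: (V e z) (V _ (incl w)) (_ ^+ sgn _) => a b c; ring.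
Qed.

Lemma V_gen_z m : (m <= k.+1)%N -> V (fun i => (i == m)%:R) z = (-1) ^+ m.
Proof.
move=> mk; rewrite V_xi (bigD1 (inord m : 'I_k.+2)) //= inordK // eqxx mulr1.
rewrite big1 ?addr0 // => i; rewrite -val_eqE /= inordK // => /negPf ->.
by rewrite mulr0.
Qed.

(** The common kernel of the homomorphisms to the dihedral group. *)
Definition translation_free : {pred Fn} :=
  fun w => `[< forall e, V e (incl w) = 0 >].

Lemma translation_freeP w : reflect (forall e, V e (incl w) = 0) (w \in translation_free).
Proof. exact: asboolP. Qed.

Lemma translation_free_sgn w : w \in translation_free -> sgn (incl w) = false.
Proof. by move=> /translation_freeP/(_ (fun=> 1)); rewrite V_const; case: sgn. Qed.

Lemma V_incl_high w m : (k < m)%N -> V (fun i => (i == m)%:R) (incl w) = 0.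
Proof.
move=> km; elim/fgen_ind: w => [|i w IHw|i w IHw]; first by rewrite mmorph1 V1.
  by rewrite gmulfM /= incl_gen V_genM IHw ltn_eqF // (leq_trans (ltn_ord i)).
by rewrite gmulfM mmorphV /= incl_gen V_genVM IHw ltn_eqF // (leq_trans (ltn_ord i)).
Qed.

Lemma V_incl w e f : (forall j, (j <= k)%N -> e j = f j) ->
  V e (incl w) = V f (incl w).
Proof.
move=> ef; elim/fgen_ind: w => [|i w IHw|i w IHw]; first by rewrite mmorph1 !V1.
  by rewrite gmulfM /= incl_gen !V_genM IHw ef // -ltnS.
by rewrite gmulfM mmorphV /= incl_gen !V_genVM IHw ef // -ltnS.
Qed.

Lemma V_add e f (x : F) : V (fun i => e i + f i) x = V e x + V f x.
Proof.
elim/fgen_ind: x => [|i x IHx|i x IHx]; first by rewrite !V1 addr0.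
  by rewrite !V_genM IHx; ring.
by rewrite !V_genVM IHx; ring.
Qed.

(** By [fam_push], [push w] lies in the kernel if all [V e (incl w)] vanish.
    Conversely, testing [fam_push] on a basis vector [m] other than [j] and
    [j.+1], on which [V _ z] is a sign, shows that the values of [incl w] at
    [j] and [j.+1] are opposite for all [j]; they vanish because the last
    one does. *)
Lemma kernel_push w : (0 < k)%N ->
  (push w \in burau_kernel k.+2) = (w \in translation_free).
Proof.
move=> k0; apply/idP/idP => [/burau_kernelP[_ h]|wU]; last first.
  apply/burau_kernelP; split; first exact: braid_perm_push.
  move=> e j jk; rewrite fam_push // translation_free_sgn //.
  by move/translation_freeP: wU => ->; ring.
have h2 j : (j <= k)%N -> V (fun i => (i == j)%:R + (i == j.+1)%:R) (incl w) = 0.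
  move=> jk; have [m [mk mj mj1]] : exists m, [/\ (m <= k.+1)%N, m != j & m != j.+1].
    have [->|j0] := eqVneq j 0%N; first by exists 2; split=> //; lia.
    by exists 0%N; split; lia.
  have := h (fun i => (i == m)%:R) j jk; rewrite fam_push // V_gen_z //.
  rewrite ![(_ == m)]eq_sym (negPf mj) (negPf mj1) subrr mulr0 add0r.
  move/eqP; rewrite -mulr_natr !mulf_eq0 signr_eq0 orbF => /orP[/eqP //|//].
have h3 d j : (d + j = k.+1)%N -> V (fun i => (i == j)%:R) (incl w) = 0.
  elim: d j => [|d IHd] j ej; first by apply: V_incl_high; lia.
  have := h2 j; rewrite V_add (IHd j.+1) ?addr0; first by apply; lia.
  by lia.
apply/translation_freeP => e.
rewrite (@V_incl _ _ (fun j => if (j <= k)%N then e j else 0)); last by move=> j ->.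
rewrite (@V_comb _ k.+1); last by move=> j kj; rewrite leqNgt kj.
rewrite big1 // => j _; rewrite (h3 (k.+1 - j)%N) ?mulr0 // subnK //.
exact: ltnW.
Qed.

End Completion.

(** * Centres and linking numbers *)

Section Centres.
Variable k : nat.
Hypothesis k_gt0 : (0 < k)%N.
Local Notation BS := (braid_group k.+2).
Local Notation Fn := (free_group 'I_k.+1).

Lemma ord01 : (inord 0 : 'I_k.+1) != inord 1.
Proof. by apply/eqP => /(congr1 val); rewrite /= !inordK. Qed.

Lemma conj_inj_free (p q : Fn) : (forall x, x ^ p = x ^ q) -> p = q.
Proof.
move=> h; apply/divg1_eq/(free_centre_trivial ord01) => v.
by apply/commute_sym/conj_fix_commute; rewrite conjgM h conjgK.
Qed.

(** Let [a] belong to an abelian set of pure braids that is stable under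
    conjugation by [push].  The commutator of [a] and [push w] acts on the free
    group as the conjugation by some [t] that commutes with all its
    conjugates, so that [t = 1]: the action of [a] fixes every [w]. *)
Lemma abelian_normalised_by_push (A : {pred BS}) :
  {in A, forall x, @braid_perm k.+2 x = 1} ->
  {in A &, forall x y, commute x y} ->
  {in A, forall x w, x ^ push w \in A} ->
  {in A, forall a, exists m, a = zpow (delta k.+1) m}.
Proof.
move=> pA cA nA a aA; apply: kernel_alpha; first exact: pA.
move=> w; suff t1 : (alpha a w)^-1 * w = 1.
  by apply: (mulgI (alpha a w)^-1); rewrite t1 mulVg.
apply: (commute_conjugates_trivial ord01) => v.
have [u eu] : exists u, u = a^-1 * a ^ push w by eexists.
have [u' eu'] : exists u', u' = u ^ push v by eexists.
have au x : alpha u x = x ^ ((alpha a w)^-1 * w).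
  rewrite eu conjgE !alphaM -mmorphV !alpha_push mmorphJ mmorphV /= -!alphaM.
  by rewrite mulVg alpha1 conjgM.
have au' x : alpha u' x = x ^ (((alpha a w)^-1 * w) ^ v).
  rewrite eu' conjgE !alphaM -mmorphV !alpha_push au -!conjgM.
  by congr (x ^ _); rewrite [RHS]conjgE !mulgA.
have cu : commute u u'.
  have av : a ^ push v \in A by apply: nA.
  have aw : a ^ push w \in A by apply: nA.
  have avw : (a ^ push w) ^ push v \in A by apply: nA.
  rewrite eu' eu conjMg conjVg.
  by apply: commuteM; apply: commuteMl; 
    do ?[apply: commuteV | apply/commute_sym/commuteV/commute_sym]; apply: cA.
apply: conj_inj_free => x.
by rewrite [LHS]conjgM [RHS]conjgM -!au -!au' -!alphaM cu.
Qed.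

Lemma kernel_normal (x y : BS) : x \in burau_kernel k.+2 ->
  x ^ y \in burau_kernel k.+2.
Proof.
have E (g : BS) : (g \in burau_kernel k.+2) =
    (@braid_perm k.+2 g == 1) && (burau (unitrN1 int) k.+2 g == 1) by [].
by rewrite !E => /andP[/eqP e1 /eqP e2]; rewrite !mmorphJ /= e1 e2 !conj1g !eqxx.
Qed.

Lemma centre_kernel_delta (x : BS) : x \in center_of (burau_kernel k.+2) ->
  exists m, x = zpow (delta k.+1) m.
Proof.
apply: (abelian_normalised_by_push (A := center_of (burau_kernel k.+2))).
- by move=> y /center_ofP[/burau_kernelP[]].
- by move=> y y' /center_ofP[_ cy] /center_ofP[ky' _]; apply: cy.
- move=> y /center_ofP[ky cy] w; apply/center_ofP; split; first exact: kernel_normal.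
  move=> y' ky'; rewrite -(conjgKV (push w) y').
  by apply/commuteJ/cy/kernel_normal.
Qed.

(** A permutation commuting with all adjacent transpositions preserves every pair
    of neighbours, hence is trivial on at least three points. *)
Lemma centre_perm (x : BS) : x \in center_of (whole BS) -> @braid_perm k.+2 x = 1.
Proof.
move=> /center_ofP[_ cx]; set p := @braid_perm k.+2 x.
have near (i : nat) (h : (i < k.+1)%N) (j : 'I_k.+2) :
    (j == i :> nat) || (j == i.+1 :> nat) -> (p j == i :> nat) || (p j == i.+1 :> nat).
  pose o : 'I_k.+1 := Ordinal h.
  pose l := @lstrand k.+2 o; pose r := @rstrand k.+2 o.
  have e : tperm (p l) (p r) = tperm l r.
    rewrite -tpermJ; apply/commute_conj; rewrite -[tperm l r]/(@strand_swap k.+2 o).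
    rewrite -(braid_perm_sig h); apply: gmulf_commute.
    by apply/commute_sym/cx.
  have lr : l != r by apply/eqP => /(congr1 val) /=; lia.
  have pl : p l = l \/ p l = r.
    have := tpermL (p l) (p r); rewrite e.
    case: tpermP => [->|->|_ _ /perm_inj e']; [by left|by right|].
    by rewrite e' eqxx in lr.
  have pr : p r = l \/ p r = r.
    have := tpermR (p l) (p r); rewrite e.
    case: tpermP => [->|->|_ _ /perm_inj e']; [by left|by right|].
    by rewrite e' eqxx in lr.
  have -> : (p j == i :> nat) || (p j == i.+1 :> nat) = (p j \in [:: l; r]).
    by rewrite !inE -!val_eqE.
  case/orP => /eqP ej.
    have -> : j = l by apply: val_inj.
    by case: pl => ->; rewrite !inE eqxx ?orbT.
  have -> : j = r by apply: val_inj.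
  by case: pr => ->; rewrite !inE eqxx ?orbT.
have mid (j : 'I_k.+2) : (0 < j < k.+1)%N -> p j = j.
  move=> jk; apply: val_inj.
  have lt1 : (j < k.+1)%N by lia.
  have lt2 : (j.-1 < k.+1)%N by lia.
  have h1 := near j lt1 j; have h2 := near j.-1 lt2 j.
  rewrite eqxx /= in h1; rewrite prednK ?eqxx ?orbT in h2; last lia.
  by have := h1 isT; have := h2 isT; rewrite /=; lia.
have inj_val (i j : 'I_k.+2) : p i = p j :> nat -> i = j :> nat.
  by move=> /val_inj/perm_inj ->.
apply/permP => j; rewrite perm1; have [jm|jm] := boolP (0 < j < k.+1)%N.
  exact: mid.
apply: val_inj => /=; have [j0|j0] := eqVneq (j : nat) 0%N.
  have m1 : (1 < k.+2)%N by lia.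
  have := inj_val j (Ordinal m1); rewrite (mid (Ordinal m1)) /= ?j0; last by rewrite /=; lia.
  have := @near 0%N isT j; rewrite j0 => /(_ isT) /orP[/eqP -> //|/eqP ->].
  by move=> /(_ erefl).
have jk : j = k.+1 :> nat by have := ltn_ord j; lia.
have := @near k (ltnSn k) j; rewrite jk eqxx orbT => /(_ isT).
have m1 : (k < k.+2)%N by lia.
have := inj_val j (Ordinal m1); rewrite (mid (Ordinal m1)) /= ?jk; last by rewrite /=; lia.
move=> h1 /orP[/eqP e|/eqP e] //.
by have := h1 e; lia.
Qed.

Lemma centre_braid_delta (x : BS) :
  reflect (exists m, x = zpow (delta k.+1) m) (x \in center_of (whole BS)).
Proof.
apply: (iffP idP) => [|[m ->]].
  apply: (abelian_normalised_by_push (A := center_of (whole BS))).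
  - exact: centre_perm.
  - by move=> y y' /center_ofP[_ cy] /center_ofP[ky' _]; apply: cy.
  - move=> y /center_ofP[ky cy] w; apply/center_ofP; split=> // y' _.
    by rewrite commute_conj; apply: cy.
apply/center_ofP; split=> // y _.
by apply/commute_sym/commute_zpow/commute_sym/delta_central.
Qed.

Lemma centre_kernel_even (x : BS) : ~~ odd k ->
  (x \in center_of (burau_kernel k.+2)) = (x \in center_of (whole BS)).
Proof.
move=> ek; apply/idP/centre_braid_delta; first exact: centre_kernel_delta.
move=> [m ->]; apply/center_ofP; split; first by apply/zpow_closed/kernel_delta.
move=> y _; apply/commute_sym/commute_zpow/commute_sym/delta_central.
Qed.

End Centres.

(** Replacing signs by [1] in the alternating sum [V] changes it by an even
    number. *)
Lemma expo_V m x : exists c : int, expo m x = (V (fun i => (i == m)%:R) x + (c + c))%R.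
Proof.
elim/fgen_ind: x => [|i x [c IHx]|i x [c IHx]].
- by exists 0%R; rewrite expo1 V1.
- exists (V (fun i => (i == m)%:R) x + c)%R; rewrite expoM expo_gen V_genM IHx.
  by case: eqP => _ /=; ring.
- exists (V (fun i => (i == m)%:R) x + c - (i == m)%:R)%R.
  rewrite expoM expoV expo_gen V_genVM IHx.
  by case: eqP => _ /=; ring.
Qed.

Section Linking.
Variable k : nat.
Local Notation B := (braid_group k.+1).
Implicit Types b c : B.

(** The linking number of the first two strands of a pure braid.  A conjugating
    element [g] is only determined up to powers of [X 0], which do not affect
    its exponent sum in [X 1]. *)
Definition lam b : int :=
  if pselect (exists g, X 0 |> b = X 0 ^ g) is left h
  then expo 1 (projT1 (cid h)) else 0%R.

Lemma lamE b g : X 0 |> b = X 0 ^ g -> lam b = expo 1 g.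
Proof.
move=> e; rewrite /lam; case: pselect => [h|[]]; last by exists g.
case: cid => g' /= e'.
have /centraliser_fgen[m em] : commute (g' * g^-1) (X 0).
  by apply/commute_sym/conj_fix_commute; rewrite conjgM -e' e conjgK.
have := congr1 (expo 1) em; rewrite expoM expoV expo_zpow expo_gen mul0r.
by lia.
Qed.

Lemma pure_gen b : @braid_perm k.+1 b = 1 ->
  forall i, exists g, X i |> b = X i ^ g.
Proof.
move=> pb i; have [lt|le] := ltnP i k.+1; last first.
  by exists 1; rewrite artin_high ?conjg1.
have [g e] := artin_perm b (Ordinal lt); exists g.
by rewrite pb perm1 in e.
Qed.

Lemma expo_artin b m x : @braid_perm k.+1 b = 1 -> expo m (x |> b) = expo m x.
Proof.
move=> pb; elim/fgen_ind: x => [|i x IHx|i x IHx].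
- by rewrite artin1.
- by rewrite artinM !expoM IHx; have [g ->] := pure_gen pb i; rewrite expoJ.
- by rewrite artinM artinV !expoM !expoV IHx; have [g ->] := pure_gen pb i; rewrite expoJ.
Qed.

Lemma lamM b c : @braid_perm k.+1 b = 1 -> @braid_perm k.+1 c = 1 ->
  lam (b * c) = (lam b + lam c)%R.
Proof.
move=> pb pc; have [g eg] := pure_gen pb 0; have [h eh] := pure_gen pc 0.
rewrite (lamE eg) (lamE eh) (@lamE _ (h * (g |> c))).
  by rewrite expoM expo_artin // addrC.
by rewrite artin_actM eg artinJ eh conjgM.
Qed.

(** A braid of the kernel maps [X 0] to [X 0 ^ g] and fixes all values of [V] on
    [X 0]; hence [V] vanishes on [g] for the basis vector [1], and the
    corresponding exponent sum is even. *)
Lemma lam_kernel b : ~~ odd k -> b \in burau_kernel k.+1 ->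
  exists c : int, lam b = (c + c)%R.
Proof.
move=> ek kb; have /burau_kernelP[pb _] := kb.
have [g eg] := pure_gen pb 0; rewrite (lamE eg).
have [c ->] := expo_V 1 g; exists c.
have := @kernel_fam_odd k b (fun i => (i == 1%N)%:R)%R ek kb 0%N.
rewrite /fam eg VJ ?sgn_gen // V_gen /=.
by case: (sgn g); rewrite /= ?expr1 ?expr0; lia.
Qed.

(** The full twist has linking number [1], so this power of it makes the linking
    number vanish. *)
Definition unlink b : B := b * zpow (delta k) (- lam b)%R.

Lemma braid_perm_zpow_delta m : @braid_perm k.+1 (zpow (delta k) m) = 1.
Proof.
rewrite zpow_morph /= braid_perm_delta.
by case: m => n /=; rewrite expg1n ?invg1.
Qed.

Lemma unlinkM b c : @braid_perm k.+1 b = 1 -> @braid_perm k.+1 c = 1 ->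
  unlink (b * c) = unlink b * unlink c.
Proof.
move=> pb pc; rewrite /unlink lamM // opprD zpowD.
have cc m x : zpow (delta k) m * x = x * zpow (delta k) m.
  by apply/commute_sym/commute_zpow/commute_sym/delta_central.
by rewrite -!mulgA; congr (_ * _); rewrite !mulgA cc -!mulgA.
Qed.

(** The linking number is even on the kernel, and the square of the full twist
    belongs to the kernel. *)
Lemma unlink_kernel b : ~~ odd k -> b \in burau_kernel k.+1 ->
  unlink b \in burau_kernel k.+1.
Proof.
move=> ek kb; rewrite /unlink gpredMr //.
have [c ->] := lam_kernel ek kb; rewrite opprD zpow_double.
exact/zpow_closed/kernel_delta_sqr.
Qed.

Hypothesis k_gt0 : (0 < k)%N.

Lemma lam_zpow_delta m : lam (zpow (delta k) m) = m.
Proof.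
rewrite (lamE (artin_zpow_delta _ _)) // expo_zpow expo_xi ?mul1r //.
Qed.

Lemma lam_unlink b : @braid_perm k.+1 b = 1 -> lam (unlink b) = 0%R.
Proof.
by move=> pb; rewrite lamM ?braid_perm_zpow_delta // lam_zpow_delta subrr.
Qed.

End Linking.

Lemma unlink1_centre k (b : braid_group k.+2) : (0 < k)%N ->
  b \in burau_kernel k.+2 ->
  (unlink b == 1) = (b \in center_of (burau_kernel k.+2)).
Proof.
move=> k0 kb; apply/eqP/idP => [e|/(centre_kernel_delta k0)[m ->]].
  have eb : b = zpow (delta k.+1) (lam b).
    by apply/divg1_eq; rewrite -zpowN.
  apply/center_ofP; split=> // y _; rewrite eb.
  by apply/commute_sym/commute_zpow/commute_sym/delta_central.
by rewrite /unlink lam_zpow_delta // zpowN mulgV.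
Qed.

(** * Schreier's theorem *)

Lemma countable_enum (T : countType) (A : pred T) (f : nat -> T) :
  injective f -> (forall n, A (f n)) ->
  exists (b : nat -> T) (b' : T -> nat),
    [/\ forall n, A (b n), cancel b b' & forall y, A y -> b (b' y) = y].
Proof.
move=> f_inj Af; pose S : set T := [set x | A x]%classic.
have infS : ~ finite_set S.
  move=> fS; apply: infinite_nat; have := @inj_card_eq _ _ setT f (in2W f_inj).
  move=> /eq_finite_set <-; apply: sub_finite_set fS.
  by move=> _ [n _ <-]; exact: Af.
have /card_set_bijP[b' [_ b'_inj b'_surj]] := eq_card_nat (countableP S) infS.
have /choice[b hb] n : exists x, A x /\ b' x = n.
  by have [x Ax bx] := b'_surj n I; exists x.
exists b, b'; split=> [n|n|y Ay]; first by have [] := hb n.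
  by have [] := hb n.
have [Ab eb] := hb (b' y).
by apply: b'_inj => //; rewrite inE.
Qed.

(** Schreier's theorem for the stabiliser of a point in a set on which a free
    group acts. *)
Section Schreier.
Variables (I : countType) (Q : countType).
Local Notation F := (free_group I).
Local Notation x_ := (@fgen I).
Variable act : Q -> F -> Q.
Hypothesis act1 : forall q, act q 1 = q.
Hypothesis actM : forall q x y, act q (x * y) = act (act q x) y.
Variables (q0 : Q) (i0 : I).

Definition reach q := exists w, act q0 w = q.

Lemma reach_act q x : reach q -> reach (act q x).
Proof. by move=> [w <-]; exists (w * x); rewrite actM. Qed.

Lemma reach0 : reach q0.
Proof. by exists 1; rewrite act1. Qed.

Definition wcls (u : word I) : F := pres_class _ u.

Lemma len_ex q : exists n, `[< reach q -> exists u, size u = n /\ act q0 (wcls u) = q >].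
Proof.
have [[w e]|nr] := pselect (reach q); last by exists 0%N; apply/asboolP.
exists (size (nf w)); apply/asboolP => _; exists (nf w); split=> //.
by rewrite /wcls nfK.
Qed.

(** The distance from [q0]. *)
Definition len q := ex_minn (len_ex q).

Lemma len_word q : reach q -> exists u, size u = len q /\ act q0 (wcls u) = q.
Proof. by rewrite /len; case: ex_minnP => n /asboolP h _ /h. Qed.

Lemma len_min u : (len (act q0 (wcls u)) <= size u)%N.
Proof.
rewrite /len; case: ex_minnP => n _; apply; apply/asboolP => _.
by exists u.
Qed.

Lemma parent_ex q : exists p : Q * (I * bool), reach q -> q != q0 ->
  [/\ reach p.1, act p.1 (letter p.2) = q & (len p.1 < len q)%N].
Proof.
have [rq|nr] := pselect (reach q); last by exists (q, (i0, false)).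
have [u [su eu]] := len_word rq.
case/lastP: u su eu => [|u a] su eu.
  exists (q, (i0, false)) => _; case/eqP.
  by rewrite -eu /wcls pres_class_nil act1.
exists (act q0 (wcls u), a) => _ _; split=> /=; first by exists (wcls u).
  by rewrite -actM -eu /wcls -cats1 free_class_cat free_class1.
by rewrite -su size_rcons ltnS len_min.
Qed.

Definition parent := projT1 (choice parent_ex).

Lemma parentP q : reach q -> q != q0 ->
  [/\ reach (parent q).1, act (parent q).1 (letter (parent q).2) = q
    & (len (parent q).1 < len q)%N].
Proof. exact: (projT2 (choice parent_ex) q). Qed.

Fixpoint path_rec n q : F :=
  if n is m.+1 then
    if q == q0 then 1 else path_rec m (parent q).1 * letter (parent q).2
  else 1.

(** The path from [q0] to [q] in a spanning tree. *)
Definition tree_path q := path_rec (len q) q.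

Lemma path_rec_len q n m : reach q -> (len q <= n)%N -> (len q <= m)%N ->
  path_rec n q = path_rec m q.
Proof.
have len0 p : reach p -> (len p <= 0)%N -> p = q0.
  move=> rp lp; have [[|a u] [su <-]] := len_word rp; first exact: act1.
  by move: lp; rewrite -su.
have rec0 l : path_rec l q0 = 1 by case: l => //= l; rewrite eqxx.
elim: n m q => [|n IHn] [|m] q rq //= ln lm; try by rewrite (len0 q) // ?eqxx.
have [//|ne] := eqVneq q q0.
have [rp _ lp] := parentP rq ne.
by congr (_ * _); apply: IHn => //; lia.
Qed.

Lemma tree_path0 : tree_path q0 = 1.
Proof. by rewrite /tree_path; case: (len q0) => //= l; rewrite eqxx. Qed.

Lemma tree_path_parent q : reach q -> q != q0 ->
  tree_path q = tree_path (parent q).1 * letter (parent q).2.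
Proof.
move=> rq ne; have [rp _ lp] := parentP rq ne.
rewrite /tree_path (path_rec_len (m := (len q).+1)) //= (negPf ne).
by congr (_ * _); apply: path_rec_len => //; exact: ltnW.
Qed.

Lemma tree_ind (P : Q -> Prop) : P q0 ->
  (forall q, reach q -> q != q0 -> P (parent q).1 -> P q) ->
  forall q, reach q -> P q.
Proof.
move=> P0 PS q; have [n] := ubnP (len q); elim: n q => // n IHn q ln rq.
have [-> //|ne] := eqVneq q q0.
have [rp _ lp] := parentP rq ne.
by apply: PS => //; apply: IHn => //; lia.
Qed.

Lemma act_tree_path q : reach q -> act q0 (tree_path q) = q.
Proof.
move: q; apply: tree_ind => [|q rq ne IHq]; first by rewrite tree_path0 act1.
by rewrite tree_path_parent // actM IHq; have [] := parentP rq ne.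
Qed.

Lemma act_tree_pathV q : reach q -> act q (tree_path q)^-1 = q0.
Proof. by move=> rq; rewrite -{1}(act_tree_path rq) -actM mulgV act1. Qed.

Definition tree_edge (y : Q * I) : bool :=
  tree_path y.1 * x_ y.2 == tree_path (act y.1 (x_ y.2)).

Definition off_tree (y : Q * I) : bool := `[< reach y.1 >] && ~~ tree_edge y.

Variables (b : nat -> Q * I) (b' : Q * I -> nat).
Hypothesis off_b : forall n, off_tree (b n).
Hypothesis bK : cancel b b'.
Hypothesis b'K : forall y, off_tree y -> b (b' y) = y.

Definition loop (y : Q * I) : F :=
  tree_path y.1 * x_ y.2 * (tree_path (act y.1 (x_ y.2)))^-1.

Definition loops : free_group nat -> F := flift (fun n => loop (b n)).

HB.instance Definition _ := Multiplicative.on loops.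

Definition edge_label (y : Q * I) : free_group nat :=
  if tree_edge y then 1 else fgen (b' y).

Lemma loops_edge y : reach y.1 -> loops (edge_label y) = loop y.
Proof.
move=> ry; rewrite /edge_label; case: ifPn => [/eqP e|ne].
  by rewrite mmorph1 /loop e mulgV.
by rewrite /loops flift_gen b'K //; apply/andP; split=> //; apply/asboolP.
Qed.

(** The free group acts on pairs of a vertex and an accumulated label: following
    an edge multiplies the label by the basis element of that edge, which is
    trivial on the tree. *)
Definition label_step (i : I) (c : bool) (s : Q * free_group nat) :
    Q * free_group nat :=
  if c then (act s.1 (x_ i)^-1, s.2 * (edge_label (act s.1 (x_ i)^-1, i))^-1)
  else (act s.1 (x_ i), s.2 * edge_label (s.1, i)).

Lemma label_stepK i c s : label_step i (~~ c) (label_step i c s) = s.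
Proof.
case: s => q u; case: c; rewrite /label_step /= -!actM ?mulVg ?mulgV act1.
  by rewrite mulgVK.
by rewrite mulgK.
Qed.

Lemma label_no_rel (u v : word I) : False ->
  word_act label_step u =1 word_act label_step v.
Proof. by []. Qed.

Definition label_act := pres_act label_stepK label_no_rel.

(** The label of the path starting at [q] and following [w]. *)
Definition label q w := (label_act (q, 1) w).2.

Lemma label_act_fst s w : (label_act s w).1 = act s.1 w.
Proof.
elim/pgen_ind_r: w => [|j w IHw|j w IHw].
- by rewrite /label_act !pres_act1 act1.
- by rewrite /label_act !pres_actM !pres_act_gen -/label_act /= IHw actM.
- by rewrite /label_act !pres_actM !pres_act_genV -/label_act /= IHw actM.
Qed.

Lemma label_actE q u w : label_act (q, u) w = (act q w, u * label q w).
Proof.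
rewrite /label; elim/pgen_ind_r: w => [|i w IHw|i w IHw].
- by rewrite /label_act !pres_act1 act1 mulg1.
- rewrite /label_act !pres_actM !pres_act_gen -/label_act IHw /label_step /=.
  by rewrite label_act_fst actM mulgA.
- rewrite /label_act !pres_actM !pres_act_genV -/label_act IHw /label_step /=.
  by rewrite label_act_fst actM mulgA.
Qed.

Lemma labelM q v w : label q (v * w) = label q v * label (act q v) w.
Proof.
by rewrite /label {1}/label_act pres_actM -/label_act label_actE mul1g label_actE.
Qed.

Lemma label1 q : label q 1 = 1.
Proof. by rewrite /label /label_act pres_act1. Qed.

Lemma label_gen q i : label q (x_ i) = edge_label (q, i).
Proof. by rewrite /label /label_act pres_act_gen /= mul1g. Qed.

Lemma label_genV q i : label q (x_ i)^-1 = (edge_label (act q (x_ i)^-1, i))^-1.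
Proof. by rewrite /label /label_act pres_act_genV /= mul1g. Qed.

Lemma loops_label q w : reach q ->
  loops (label q w) = tree_path q * w * (tree_path (act q w))^-1.
Proof.
move=> rq; elim/pgen_ind_r: w => [|i w IHw|i w IHw].
- by rewrite label1 mmorph1 act1 mulg1 mulgV.
- rewrite labelM gmulfM /= IHw label_gen loops_edge; last exact: reach_act.
  by rewrite /loop /= -actM !mulgA mulgVK.
- rewrite labelM gmulfM /= IHw label_genV mmorphV /= loops_edge; last first.
    by apply/reach_act/reach_act.
  by rewrite /loop /= -!actM !invgM invgK mulgVK !mulgA mulgVK.
Qed.

Lemma label_tree_path q : reach q -> label q0 (tree_path q) = 1.
Proof.
move: q; apply: tree_ind => [|q rq ne IHq]; first by rewrite tree_path0 label1.
have [rp ep _] := parentP rq ne; have et := tree_path_parent rq ne.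
rewrite et labelM IHq mul1g act_tree_path //.
case: (parent q) rp ep et => p [i [|]] /= rp ep et.
  rewrite /letter /= in ep et *; rewrite label_genV ep /edge_label /tree_edge /=.
  have -> : act q (x_ i) = p by rewrite -ep -actM mulVg act1.
  by rewrite et mulgVK eqxx invg1.
rewrite /letter /= in ep et *; rewrite label_gen /edge_label /tree_edge /=.
by rewrite ep et eqxx.
Qed.

(** By [loops_label], [label q0] is a right inverse of [loops] on the stabiliser.
    It is also a left inverse: paths in the tree have trivial label, so the
    loop through an edge outside the tree has the label of that edge. *)
Theorem schreier_free :
  injective loops /\ forall w, act q0 w = q0 <-> exists y, loops y = w.
Proof.
have loop0 n : act q0 (loops (fgen n)) = q0.
  have /andP[/asboolP rn _] := off_b n.
  rewrite /loops flift_gen /loop !actM act_tree_path //.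
  exact/act_tree_pathV/reach_act.
have loop0V n : act q0 (loops (fgen n))^-1 = q0.
  by rewrite -[X in act X _](loop0 n) -actM mulgV act1.
have loops0 y : act q0 (loops y) = q0.
  elim/fgen_ind: y => [|n y IHy|n y IHy]; first by rewrite mmorph1 act1.
    by rewrite gmulfM actM loop0.
  by rewrite gmulfM actM mmorphV loop0V.
have labelK y : label q0 (loops y) = y.
  have gen n : label q0 (loops (fgen n)) = fgen n.
    have /andP[/asboolP rn nt] := off_b n.
    rewrite /loops flift_gen /loop !labelM label_tree_path // mul1g.
    rewrite !actM act_tree_path // label_gen.
    have := label_tree_path (reach_act (x_ (b n).2) rn).
    set p := act _ _; set t := tree_path p => lt.
    have : label q0 (t * t^-1) = 1 by rewrite mulgV label1.
    rewrite labelM lt mul1g act_tree_path; last exact: reach_act.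
    by move=> ->; rewrite mulg1 -surjective_pairing /edge_label (negPf nt) bK.
  elim/fgen_ind: y => [|n y IHy|n y IHy]; first by rewrite mmorph1 label1.
    by rewrite gmulfM labelM loop0 IHy gen.
  rewrite gmulfM labelM loops0 IHy; congr (_ * _).
  apply: (mulgI (fgen n)); rewrite mulgV -[X in X * _]gen.
  by rewrite -[in X in _ * X](loop0 n) -labelM -gmulfM mulgV mmorph1 label1.
split=> [|w]; first exact: can_inj labelK.
split=> [e|[y <-]]; last exact: loops0.
exists (label q0 w).
by rewrite loops_label ?e ?tree_path0 ?mul1g ?invg1 ?mulg1 //; exact: reach0.
Qed.

End Schreier.

Section InfiniteRank.
Variables (I : countType) (Q : countType).
Local Notation F := (free_group I).
Variable act : Q -> F -> Q.
Hypothesis act1 : forall q, act q 1 = q.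
Hypothesis actM : forall q x y, act q (x * y) = act (act q x) y.
Variables (q0 : Q) (i0 : I).
Hypothesis i0_inv : forall q, act (act q (fgen i0)) (fgen i0) = q.
Variable f : nat -> Q.
Hypothesis f_inj : injective f.
Hypothesis f_reach : forall n, exists w, act q0 w = f n.
Hypothesis f_disj : forall m n, f m <> act (f n) (fgen i0).

(** If a generator acts as an involution, then the two edges that it defines
    between [q] and its image cannot both lie in the spanning tree, since
    generators have infinite order.  This gives infinitely many edges outside
    the tree, which label a basis. *)
Lemma schreier_infinite_rank :
  exists nu : {multiplicative free_group nat -> F},
    injective nu /\ forall w, act q0 w = q0 <-> exists y, nu y = w.
Proof.
pose off := off_tree act1 actM q0 i0.
pose edge m : Q * I := if off (f m, i0) then (f m, i0) else (act (f m) (fgen i0), i0).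
have edge_off m : off (edge m).
  rewrite /edge; case: ifPn => // /nandP[/asboolPn[]|]; first exact: f_reach.
  rewrite negbK => /eqP /= e1; apply/andP; split.
    by apply/asboolP; apply: (reach_act actM); exact: f_reach.
  apply/negP => /eqP /= e2; rewrite i0_inv -e1 in e2.
  have e3 : zpow (fgen i0) (1 + 1)%R = 1.
    apply: (mulgI (tree_path act1 actM q0 i0 (f m))).
    by rewrite mulg1 zpowS [zpow _ _]/(fgen i0) mulgA.
  by have := fgen_zpow_inj e3.
have edge_inj : injective edge.
  move=> m n; rewrite /edge; case: ifP => _; case: ifP => _ [] e.
  - exact: f_inj.
  - by case: (f_disj e).
  - by case: (f_disj (esym e)).
  - by apply: f_inj; rewrite -[LHS]i0_inv e i0_inv.
have [b [b' [off_b bK b'K]]] := countable_enum (A := off) edge_inj edge_off.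
by have := schreier_free off_b bK b'K; exists (loops act1 actM q0 i0 b).
Qed.

End InfiniteRank.

(** * The free normal subgroup *)

Section TranslationFree.
Variable k : nat.
Local Notation Fn := (free_group 'I_k.+1).
Local Notation U := (@translation_free k).

Lemma translation_freeM : mulg_closed U.
Proof.
move=> x y /translation_freeP hx /translation_freeP hy; apply/translation_freeP => e.
by rewrite gmulfM VM hx hy mulr0 addr0.
Qed.

Lemma translation_free1 : 1 \in U.
Proof. by apply/translation_freeP => e; rewrite mmorph1 V1. Qed.

Lemma translation_freeV : invg_closed U.
Proof.
move=> x /translation_freeP hx; apply/translation_freeP => e.
by rewrite mmorphV VVg hx mulr0 oppr0.
Qed.

HB.instance Definition _ := isMulClosed.Build Fn U translation_freeM.
HB.instance Definition _ := isMul1Closed.Build Fn U translation_free1.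
HB.instance Definition _ := isInvClosed.Build Fn U translation_freeV.

Lemma translation_free_artin w (b : braid_group k.+1) :
  w \in U -> alpha (iota_braid b) w \in U.
Proof.
move=> /translation_freeP hw; apply/translation_freeP => e.
by rewrite /alpha artin_iota incl_fill_artin V_artin.
Qed.

Lemma translation_free_sqr w : sgn (incl w) = true -> w * w \in U.
Proof.
move=> sw; apply/translation_freeP => e.
by rewrite gmulfM VM sw expr1 mulN1r subrr.
Qed.

Lemma translation_free_fxi c : ~~ odd k -> zpow (fxi k) (c + c)%R \in U.
Proof.
move=> ek; rewrite zpow_double; apply/zpow_closed/translation_free_sqr.
by rewrite incl_fxi sgn_xi.
Qed.

(** The free group acts through its dihedral images on these states, and the
    stabiliser of the origin is [U]. *)
Definition dih_state : Type := ({ffun 'I_k.+1 -> int} * bool)%type.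

HB.instance Definition _ := Countable.on dih_state.

Definition coord (w : Fn) (j : 'I_k.+1) : int :=
  V (fun i => (i == j)%:R)%R (incl w).

Definition dih_act (q : dih_state) (w : Fn) : dih_state :=
  ([ffun j => q.1 j + (-1) ^+ q.2 * coord w j]%R, q.2 (+) sgn (incl w)).

Lemma dih_act1 q : dih_act q 1 = q.
Proof.
case: q => v s; congr (_, _); last by rewrite mmorph1 sgn1 addbF.
by apply/ffunP => j; rewrite ffunE /coord mmorph1 V1 mulr0 addr0.
Qed.

Lemma dih_actM q x y : dih_act q (x * y) = dih_act (dih_act q x) y.
Proof.
case: q => v s; congr (_, _) => /=; last by rewrite gmulfM sgnM addbA.
apply/ffunP => j; rewrite !ffunE /coord gmulfM VM signr_addb.
by rewrite mulrDr addrA mulrA.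
Qed.

Definition dih_origin : dih_state := ([ffun=> 0%R], false).

Lemma dih_stabiliser w : dih_act dih_origin w = dih_origin <-> w \in U.
Proof.
split=> [e|wU].
  have c0 j : coord w j = 0%R.
    have := congr1 (fun q : dih_state => q.1 j) e.
    by rewrite /= !ffunE add0r mul1r.
  apply/translation_freeP => e'.
  rewrite (@V_incl _ _ _ (fun j => if (j <= k)%N then e' j else 0%R)); last by move=> j ->.
  rewrite (@V_comb _ k.+1); last by move=> j kj; rewrite leqNgt kj.
  by rewrite big1 // => j _; rewrite -/(coord w j) c0 mulr0.
congr (_, _); last by rewrite translation_free_sgn.
apply/ffunP => j; rewrite !ffunE /coord.
by move/translation_freeP: wU => ->; rewrite mulr0 addr0.
Qed.

Hypothesis k_gt0 : (0 < k)%N.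

Let i0 : 'I_k.+1 := inord 0.
Let i1 : 'I_k.+1 := inord 1.

Lemma coord_power m : coord ((fgen i0 * fgen i1) ^+ m) i0 = Posz m.
Proof.
rewrite /coord mmorphX gmulfM /= !incl_gen !inordK //.
elim: m => [|m IHm]; first by rewrite V1.
by rewrite expgS -mulgA !V_genM IHm /=; lia.
Qed.

Lemma sgn_power m : sgn (incl ((fgen i0 * fgen i1) ^+ m)) = false.
Proof.
rewrite mmorphX gmulfM /= !incl_gen; elim: m => [|m IHm]; first by rewrite sgn1.
by rewrite expgS !sgnM !sgn_gen IHm.
Qed.

(** The powers of [fgen i0 * fgen i1] translate the origin by different vectors,
    and [fgen i0] is a reflection of the states; so there are infinitely many
    states and [schreier_infinite_rank] applies. *)
Lemma translation_free_free :
  exists nu : {multiplicative free_group nat -> Fn},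
    injective nu /\ forall w, w \in U <-> exists y, nu y = w.
Proof.
pose f m := dih_act dih_origin ((fgen i0 * fgen i1) ^+ m).
have f2 m : (f m).2 = false by rewrite /= sgn_power.
have f1 m : (f m).1 i0 = Posz m by rewrite ffunE ffunE coord_power add0r mul1r.
have inv q : dih_act (dih_act q (fgen i0)) (fgen i0) = q.
  have iU : fgen i0 * fgen i0 \in U.
    by apply: translation_free_sqr; rewrite incl_gen sgn_gen.
  rewrite -dih_actM; case: q => v s; congr (_, _) => /=.
    apply/ffunP => j; rewrite ffunE /coord.
    by move/translation_freeP: iU => ->; rewrite mulr0 addr0.
  by rewrite translation_free_sgn // addbF.
have f_inj : injective f.
  move=> m n e; apply/eqP; rewrite -[m == n]/(Posz m == Posz n).
  by rewrite -!f1 e.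
have f_disj m n : f m <> dih_act (f n) (fgen i0).
  move=> /(congr1 snd); rewrite [RHS]/= -/(f n) f2.
  by rewrite sgn_power incl_gen sgn_gen.
have f_reach n : exists w, dih_act dih_origin w = f n by eexists.
have [nu [nu_inj im]] := schreier_infinite_rank dih_act1 dih_actM inv f_inj f_reach f_disj.
by exists nu; split=> // w; rewrite -im -dih_stabiliser.
Qed.

End TranslationFree.

(** * Decomposition of the kernel *)

Lemma gisog_of_inverse (G H : groupType) (f : {multiplicative H -> G}) :
  injective f -> (forall x, exists y, f y = x) -> gisog G H.
Proof.
move=> f_inj /choice[g fg].
have gf y : g (f y) = y by apply: f_inj.
have gM : {morph g : x y / x * y} by apply: can2_gmulfM gf fg.
pose g' : {multiplicative G -> H} := HB.pack g (isMultiplicative.Build G H g gM).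
by exists g'; exists f.
Qed.

Arguments delta : simpl never.

Section Decomposition.
Variable k : nat.
Hypothesis k_gt0 : (0 < k)%N.
Hypothesis even_k : ~~ odd k.
Local Notation B := (braid_group k.+1).
Local Notation BS := (braid_group k.+2).
Local Notation Fn := (free_group 'I_k.+1).
Local Notation z := (xi k.+2).
Local Notation U := (@translation_free k).
Local Notation K1 := (burau_kernel k.+1).
Local Notation K2 := (burau_kernel k.+2).
Local Notation iota := (@iota_braid k).

Lemma fam_low (e f : nat -> int) (b : B) j : (forall i, (i <= k)%N -> e i = f i) ->
  (j <= k)%N -> fam e b j = fam f b j.
Proof.
move=> ef jk; rewrite /fam -(incl_ffgen (jk : (j < k.+1)%N)) -incl_fill_artin.
exact: V_incl.
Qed.

Lemma pure_of_push_iota w (b : B) : @braid_perm k.+2 (push w * iota b) = 1 ->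
  @braid_perm k.+1 b = 1.
Proof.
rewrite gmulfM /= braid_perm_push mul1g => pb.
apply/permP => j; rewrite perm1; apply: val_inj => /=.
have [g eg] := artin_perm b j; have [h eh] := pure_gen pb j.
by rewrite artin_iota eg in eh; exact: gen_conj_inj eh.
Qed.

(** For a family that vanishes on [z], the braid [push w] with [w] of even
    length acts trivially on differences, so that the condition on
    [push w * iota b] becomes a condition on [b] alone. *)
Lemma kernel_split_even w (b : B) : sgn (incl w) = false ->
  push w * iota b \in K2 -> w \in U /\ b \in K1.
Proof.
move=> sw kx; have /burau_kernelP[px hx] := kx.
have kb : b \in K1.
  apply/burau_kernelP; split; first exact: pure_of_push_iota px.
  move=> e j jk.
  (* The value at [k.+1] is chosen such that [V e' z] vanishes. *)
  pose e' i := if i == k.+1 then V e (xi k.+1) else e i.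
  have ee' i : (i <= k)%N -> e' i = e i by move=> ik; rewrite /e' ltn_eqF.
  have Vz : V e' z = 0%R.
    rewrite -[z]/(xi k.+1 * X k.+1) VM V_gen sgn_xi /= even_k expr1 mulN1r.
    rewrite {2}/e' eqxx -incl_fxi (@V_incl _ _ e' e) ?subrr //.
  have := hx e' j (leqW jk); rewrite !famM fam_push ?(ltnW jk) //.
  rewrite V_fam_z Vz sw mulr0 mul0rn addr0 mul1r !fam_iota !ee' ?(ltnW jk) //.
  by rewrite !(@fam_low e' e) // ltnW.
split=> //; rewrite -kernel_push //.
by rewrite gpredMr // in kx; exact: kernel_iota.
Qed.

(** The image of the decomposition of pure braids.  If [w] is odd, it is replaced
    by [w * fxi k], which is even as [k.+1] is odd; this multiplies the braid by
    the full twist and [b] by the inverse of the full twist on fewer strands. *)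
Lemma kernel_split (x : BS) : x \in K2 ->
  exists w b m, [/\ w \in U, b \in K1 & x = push w * iota b * zpow (delta k.+1) m].
Proof.
move=> kx; have /burau_kernelP[px _] := kx.
have [w [b ex]] : push_iota x by apply: push_iota_of_perm; rewrite px perm1.
case sw : (sgn (incl w)); last first.
  have [wU bK] : w \in U /\ b \in K1 by apply: kernel_split_even; rewrite -?ex.
  by exists w, b, 0%R; rewrite mulg1.
have ed : delta k.+1 = push (fxi k) * (iota (delta k))^-1 by [].
have ex' : x * delta k.+1 = push (w * fxi k) * iota ((delta k)^-1 * b).
  rewrite ex [push (w * _)]gmulfM [iota (_ * b)]gmulfM mmorphV.
  by rewrite -!mulgA; congr (_ * _); rewrite -delta_central ed -mulgA.
have [wU bK] : w * fxi k \in U /\ (delta k)^-1 * b \in K1.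
  apply: kernel_split_even; last by rewrite -ex' gpredM // kernel_delta.
  by rewrite gmulfM sgnM sw /= incl_fxi sgn_xi /= even_k.
exists (w * fxi k), ((delta k)^-1 * b), (- 1)%R; split=> //.
by rewrite -ex' zpowN mulgK.
Qed.

Lemma iota_zpow_delta l :
  iota (zpow (delta k) l) = push (zpow (fxi k) l) * zpow (delta k.+1) (- l)%R.
Proof.
have c : commute (push (fxi k)) (iota (delta k))^-1.
  exact/commuteV/commute_push_fxi.
rewrite [delta k.+1]/(push (fxi k) * (iota (delta k))^-1) (zpowM _ c) !zpow_morph /=.
by rewrite zpowVg opprK mulgA -zpowD subrr mul1g.
Qed.

Lemma push_iota_twist w (b : B) l :
  push w * iota (b * zpow (delta k) l) =
  push (w * zpow (fxi k) l) * iota b * zpow (delta k.+1) (- l)%R.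
Proof.
rewrite [iota (b * _)]gmulfM [push (w * _)]gmulfM /= iota_zpow_delta -!mulgA.
congr (_ * _); rewrite !mulgA; congr (_ * _); rewrite zpow_morph.
exact: (commute_zpow _ (commute_sym (commute_push_fxi _))).
Qed.

Lemma kernel_split_unlink (x : BS) : x \in K2 ->
  exists w b m, [/\ w \in U, b \in K1 &
    x = push w * iota (unlink b) * zpow (delta k.+1) m].
Proof.
move=> /kernel_split[w [b [m [wU bK ->]]]].
have [c ec] := lam_kernel even_k bK.
exists (w * zpow (fxi k) (lam b)), b, (- lam b + m)%R; split=> //.
  by rewrite ec; apply: gpredM wU (translation_free_fxi _ even_k).
have eb : b = unlink b * zpow (delta k) (lam b).
  by rewrite /unlink zpowN mulgVK.
by rewrite {1}eb push_iota_twist zpowD !mulgA.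
Qed.

Lemma alpha_zpow_delta m w : alpha (zpow (delta k.+1) m) w = w.
Proof.
have := @free_morph_eq _ _ (@alpha k (zpow (delta k.+1) m)) idfun; apply=> j.
rewrite /= /alpha incl_gen artin_zpow_delta; last exact: ltnW.
rewrite mmorphJ zpow_morph /= fill_z fill_gen // ffgen_ord.
have -> : zpow (1 : Fn) m = 1 by case: m => n /=; rewrite expg1n ?invg1.
by rewrite conjg1.
Qed.

(** A power of the full twist of the form [push w * iota b] is built from powers
    of [fxi k] and of the smaller full twist, which is excluded by the linking
    number. *)
Lemma push_iota_centre w (b : B) m : lam b = 0%R ->
  push w * iota b = zpow (delta k.+1) m -> w = 1 /\ b = 1.
Proof.
move=> lb e; have [y|l [-> eb]] := @push_iota_alpha1 k (@artin_faithfulP k) w b.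
  by rewrite e alpha_zpow_delta.
have l0 : l = 0%R.
  by apply/eqP; rewrite -oppr_eq0 -(lam_zpow_delta k_gt0 (- l)) -eb lb.
by rewrite eb l0 oppr0.
Qed.

End Decomposition.

(** * The semidirect product *)

Section Splitting.
Variable j : nat.
Hypothesis odd_j : odd j.
Local Notation B := (braid_group j.+2).
Local Notation BS := (braid_group j.+3).
Local Notation Fn := (free_group 'I_j.+2).
Local Notation U := (@translation_free j.+1).
Local Notation K1 := (burau_kernel j.+2).
Local Notation K2 := (burau_kernel j.+3).
Local Notation iota := (@iota_braid j.+1).

Variable nu : {multiplicative free_group nat -> Fn}.
Hypothesis nu_inj : injective nu.
Hypothesis nu_image : forall w, w \in U <-> exists y, nu y = w.

Let j_gt0 : (0 < j)%N. Proof. by case: j odd_j. Qed.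
Let even_k : ~~ odd j.+1. Proof. by rewrite /= odd_j. Qed.

Local Notation Q1 := (quot_group K1 (center_of K1) (normalises_center K1)).
Local Notation Q2 := (quot_group K2 (center_of (whole BS)) (normalises_center_whole K2)).

Lemma kernel_pure n (b : braid_group n.+1) :
  b \in burau_kernel n.+1 -> @braid_perm n.+1 b = 1.
Proof. by move=> /burau_kernelP[]. Qed.

(** A homomorphic section of the quotient map, up to the centre: [unlink] is a
    homomorphism on pure braids whose kernel in [K1] is the centre of [K1]. *)
Definition section (q : Q1) : B := unlink (val (repr q)).

Lemma section_class (x : subgroup K1) : section (quot_class _ x) = unlink (val x).
Proof.
have := cosetb_repr (normalises_center K1) x; rewrite /section /cosetb.
move: (repr _) => y yx.
have kx := kernel_pure (valP x); have ky := kernel_pure (valP y).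
have : unlink ((val y)^-1 * val x) = 1.
  apply/eqP; rewrite unlink1_centre // gpredM ?gpredV //; exact: valP.
have pV : @braid_perm j.+2 (val y)^-1 = 1 by rewrite mmorphV /= ky invg1.
rewrite unlinkM // => e; apply: (mulgI (unlink (val y)^-1)).
rewrite e -unlinkM // mulVg /unlink (@lamE _ _ 1) ?expo1 ?mulg1 //.
by rewrite artin_act1 conjg1.
Qed.

Lemma sectionM : {morph section : q r / q * r}.
Proof.
elim/quot_group_ind=> x; elim/quot_group_ind=> y.
rewrite -[quot_class _ x * _]/(quot_mul _ _) quot_mulE !section_class gmulfM.
by rewrite unlinkM //; apply: kernel_pure; apply: valP.
Qed.

HB.instance Definition _ := isMultiplicative.Build Q1 B section sectionM.

Lemma section_kernel q : section q \in K1.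
Proof. by apply: unlink_kernel => //; exact: valP. Qed.

Lemma section_lam q : lam (section q) = 0%R.
Proof. by apply: lam_unlink => //; apply: kernel_pure; exact: valP. Qed.

Lemma section_eq1 q : section q = 1 -> q = 1.
Proof.
elim/quot_group_ind: q => x; rewrite section_class => /eqP.
rewrite unlink1_centre //; last exact: valP.
by move=> xZ; apply/quot_classP; rewrite cosetb_sym /cosetb /= invg1 mul1g.
Qed.

Definition nu_inv (w : Fn) : free_group nat :=
  if pselect (exists y, nu y = w) is left h then projT1 (cid h) else 1.

Lemma nu_invK w : w \in U -> nu (nu_inv w) = w.
Proof. by move=> /nu_image h; rewrite /nu_inv; case: pselect => // h'; case: cid. Qed.

Lemma nu_in y : nu y \in U.
Proof. by apply/nu_image; exists y. Qed.

(** The action of the section on the free normal factor by conjugation. *)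
Definition twist (q : Q1) (y : free_group nat) : free_group nat :=
  nu_inv (alpha (iota (section q)^-1) (nu y)).

Lemma nu_twist q y : nu (twist q y) = alpha (iota (section q)^-1) (nu y).
Proof. by apply/nu_invK/translation_free_artin/nu_in. Qed.

Lemma twist1 y : twist 1 y = y.
Proof. by apply: nu_inj; rewrite nu_twist mmorph1 invg1 mmorph1 alpha1. Qed.

Lemma twistM q r y : twist (q * r) y = twist q (twist r y).
Proof. by apply: nu_inj; rewrite !nu_twist gmulfM invgM gmulfM alphaM. Qed.

Lemma twist_mul q x y : twist q (x * y) = twist q x * twist q y.
Proof. by apply: nu_inj; rewrite nu_twist !gmulfM /= !nu_twist. Qed.

Definition twist_action : aut_action Q1 (free_group nat) :=
  AutAction twist1 twistM twist_mul.

Local Notation S := (semidirect twist_action).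

Definition glue_val (a : S) : BS := push (nu a.1) * iota (section a.2).

Lemma glue_kernel a : glue_val a \in K2.
Proof.
apply: gpredM; first by rewrite kernel_push // nu_in.
exact/kernel_iota/section_kernel.
Qed.

Definition glue (a : S) : Q2 :=
  quot_class _ (Sub (glue_val a) (glue_kernel a) : subgroup K2).

(** Pure braids with the same action [alpha] differ by a power of the full
    twist. *)
Lemma quot_alpha (x y : subgroup K2) :
  (forall w, alpha (val x) w = alpha (val y) w) ->
  quot_class (normalises_center_whole K2) x = quot_class _ y.
Proof.
move=> e; apply/quot_classP; rewrite /cosetb.
apply/(centre_braid_delta (ltn0Sn j)).
apply: kernel_alpha => [|w].
  by apply: kernel_pure; rewrite gpredM ?gpredV; try exact: valP.
by rewrite alphaM -e -alphaM mulVg alpha1.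
Qed.

Lemma alpha_conj (s t : BS) u v w :
  alpha (push (u * alpha s^-1 v) * (s * t)) w = alpha (push u * s * (push v * t)) w.
Proof.
rewrite !alphaM !alpha_push; congr (alpha t _).
rewrite conjgM [LHS]mmorphJ /= [X in _ ^ X](_ : _ = v) //.
by rewrite -alphaM mulVg alpha1.
Qed.

Lemma glueM : {morph glue : a b / a * b}.
Proof.
move=> a b; rewrite -[glue a * _]/(quot_mul _ _) quot_mulE.
apply: quot_alpha => w; rewrite gmulfM /=.
have -> : glue_val (a * b) =
    push (nu a.1 * alpha (iota (section a.2)^-1) (nu b.1)) *
    (iota (section a.2) * iota (section b.2)).
  rewrite -nu_twist -gmulfM -gmulfM.
  by rewrite -[section a.2 * _](gmulfM (s := section)).
rewrite mmorphV /= /glue_val; exact: alpha_conj.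
Qed.

HB.instance Definition _ := isMultiplicative.Build S Q2 glue glueM.

Lemma glue_injective : injective glue.
Proof.
have ker a : glue a = 1 -> a = 1.
  case: a => y q; move=> /quot_classP; rewrite cosetb_sym /cosetb /= invg1 mul1g.
  move=> /(centre_braid_delta (ltn0Sn j))[m].
  move=> /(push_iota_centre (ltn0Sn j) (section_lam q))[e1 e2].
  have -> : y = 1 by apply: nu_inj; rewrite e1 mmorph1.
  by have -> : q = 1 by exact: section_eq1.
move=> a b e; apply/divg1_eq/ker.
by rewrite gmulfM mmorphV /= e mulgV.
Qed.

Lemma glue_surjective x : exists a, glue a = x.
Proof.
elim/quot_group_ind: x => x.
have [w [b [m [wU bK ex]]]] := kernel_split_unlink (ltn0Sn j) even_k (valP x).
pose q : Q1 := quot_class _ (Sub b bK : subgroup K1).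
exists (nu_inv w, q); apply: quot_alpha => v.
(* The power of the full twist does not affect [alpha]. *)
rewrite ex /= /glue_val [_.1]/= [_.2]/= nu_invK // section_class /=.
by rewrite [RHS]alphaM alpha_zpow_delta.
Qed.

End Splitting.

Lemma main_even (k : nat) : (1 < k)%N -> ~~ odd k ->
  center_of (burau_kernel k.+2) =i center_of (whole (braid_group k.+2)) /\
  exists phi : aut_action
      (quot_group (burau_kernel k.+1) (center_of (burau_kernel k.+1))
         (normalises_center (burau_kernel k.+1)))
      (free_group nat),
    gisog
      (quot_group (burau_kernel k.+2) (center_of (whole (braid_group k.+2)))
         (normalises_center_whole (burau_kernel k.+2)))
      (semidirect phi).
Proof.
case: k => [|j] // j0 ej; rewrite /= negbK in ej; split.
  by move=> x; apply: centre_kernel_even => //=; rewrite ej.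
have [nu [nu_inj im]] := translation_free_free (ltn0Sn j).
exists (twist_action ej nu_inj im).
pose f : {multiplicative _ -> _} := @glue j ej nu nu_inj im.
apply: (@gisog_of_inverse _ _ f).
  exact: glue_injective.
exact: glue_surjective.
Qed.

Local Close Scope group_scope.

Theorem mainTheorem9 (g : nat) (hg : 1 <= g) :
  center_of (burau_kernel (2 * g + 2)) =i
    center_of (whole (braid_group (2 * g + 2))) /\
  exists phi : aut_action
      (quot_group (burau_kernel (2 * g + 1))
         (center_of (burau_kernel (2 * g + 1)))
         (normalises_center (burau_kernel (2 * g + 1))))
      (free_group nat),
    gisog
      (quot_group (burau_kernel (2 * g + 2))
         (center_of (whole (braid_group (2 * g + 2))))
         (normalises_center_whole (burau_kernel (2 * g + 2))))
      (semidirect phi).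
Proof.
rewrite addn1 addn2; apply: main_even; first lia.
by rewrite oddM.
Qed.
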